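(* Let $n\geq 1$, and equip $\mathcal{O}(SL_n)$, $\mathcal{O}(M_n)$ and $\mathcal{O}(GL_n)$ with the semiclassical limit Poisson bracket. Then: (i) the Poisson-centralizer of $\overline{c}_{1}$ in $\mathcal{O}(SL_{n})$ is generated as a subalgebra by $\overline{c}_{1},\dots,\overline{c}_{n-1}$; (ii) the Poisson-centralizer of $c_{1}$ in $\mathcal{O}(M_{n})$ is generated as a subalgebra by $c_{1},\dots,c_{n}$; (iii) the Poisson-centralizer of $c_{1}$ in $\mathcal{O}(GL_{n})$ is generated as a subalgebra by $c_{1},\dots,c_{n},c_{n}^{-1}$.
   Context: All algebras are over $\mathbb{C}$; subalgebras are unital. A commutative Poisson algebra is a unital commutative associative algebra $A$ with a bilinear antisymmetric bracket $\{.,.\}:A\times A\to A$ satisfying the Jacobi identity and such that $\{a,.\}$ is a derivation for every $a\in A$. The Poisson-centralizer of $a\in A$ is $C(a)=\{b\in A\mid\{a,b\}=0\}$. $\mathcal{O}(M_n)=\mathbb{C}[x_{i,j}\mid 1\le i,j\le n]$ is the coordinate ring of $n\times n$ matrices (a polynomial ring in $n^2$ variables), $\det\in\mathcal{O}(M_n)$ is the determinant of the matrix $(x_{i,j})$, $\mathcal{O}(GL_n)=\mathcal{O}(M_n)[\det^{-1}]$ and $\mathcal{O}(SL_n)=\mathcal{O}(M_n)/(\det-1)$. The semiclassical limit Poisson bracket on $\mathcal{O}(M_n)$ is the unique Poisson bracket (extended by bilinearity, antisymmetry and the Leibniz rule) determined on generators by: $\{x_{i,j},x_{k,l}\}=2x_{i,l}x_{k,j}$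 if $i<k$ and $j<l$; $\{x_{i,j},x_{k,l}\}=x_{i,j}x_{k,l}$ if ($i=k$ and $j<l$) or ($j=l$ and $i<k$); and $\{x_{i,j},x_{k,l}\}=0$ if $i<k$ and $j>l$. The element $\det$ is Poisson-central (i.e. $\{\det,a\}=0$ for all $a$), and the semiclassical limit Poisson brackets on $\mathcal{O}(GL_n)$ and $\mathcal{O}(SL_n)$ are the ones induced by localizing at $\det$ and by passing to the quotient by the ideal $(\det-1)$, respectively. For $1\le i\le n$, $c_i\in\mathcal{O}(M_n)$ is the sum of all principal $i\times i$ minors of the matrix $(x_{k,l})$, i.e. the $i$-th coefficient, up to sign, of the characteristic polynomial; in particular $c_1=\sum_i x_{i,i}$ is the trace and $c_n=\det$. The same symbols denote their images in $\mathcal{O}(GL_n)$, and $\overline{c}_i$ denotes the image of $c_i$ in $\mathcal{O}(SL_n)$. *)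

(* Defs.v *)
From HB Require Import structures.
From mathcomp Require Import all_boot all_order all_algebra.
From mathcomp Require Import perm generic_quotient ring_quotient fraction ring zify.
From mathcomp Require Import boolp classical_sets mpoly.

Set Implicit Arguments.
Unset Strict Implicit.
Unset Printing Implicit Defensive.

Import GRing.Theory.
Local Open Scope ring_scope.
Local Open Scope quotient_scope.

Section PoissonAlgebras.
Variables (K : fieldType) (A : comAlgType K).

Record poisson_bracket_axioms (br : A -> A -> A) : Prop := PoissonBracketAxioms {
  poisson_linear : forall a, linear (br a);
  poisson_antisym : forall a b, br a b = - br b a;
  poisson_leibniz : forall a b c, br a (b * c) = br a b * c + b * br a c;
  poisson_jacobi :
    forall a b c, br a (br b c) + br b (br c a) + br c (br a b) = 0
}.

Definition poisson_centralizer (br : A -> A -> A) (a : A) : set A :=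
  [set b | br a b = 0]%classic.

Definition subalgebra (S : set A) : Prop :=
  [/\ S 1,
      forall (k : K) (u v : A), S u -> S v -> S (k *: u + v) &
      forall u v : A, S u -> S v -> S (u * v)].

Definition generated_subalgebra (G : set A) : set A := smallest subalgebra G.

Definition derivation (D : A -> A) : Prop :=
  linear D /\ forall b c, D (b * c) = D b * c + b * D c.

Lemma poisson_derivation br a : poisson_bracket_axioms br -> derivation (br a).
Proof. by case=> lin _ lei _; split=> [|b c]; [exact: lin | exact: lei]. Qed.

Lemma derivationD D b c : derivation D -> D (b + c) = D b + D c.
Proof. by case=> lin _; rewrite -[b]scale1r lin !scale1r. Qed.

Lemma derivation0 D : derivation D -> D 0 = 0.
Proof. by move=> dD; apply: (addIr (D 0)); rewrite -derivationD // !add0r. Qed.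

Lemma derivationZ D k b : derivation D -> D (k *: b) = k *: D b.
Proof. by move=> dD; rewrite -[k *: b]addr0 dD.1 derivation0 // addr0. Qed.

Lemma derivationN D b : derivation D -> D (- b) = - D b.
Proof. by move=> dD; rewrite -scaleN1r derivationZ // scaleN1r. Qed.

Lemma derivation1 D : derivation D -> D 1 = 0.
Proof.
move=> dD; apply: (addIr (D 1)); rewrite add0r.
by rewrite -[in RHS](mulr1 1) dD.2 mulr1 mul1r.
Qed.

Lemma derivation_sum D (I : Type) (r : seq I) (P : pred I) (F : I -> A) :
  derivation D -> D (\sum_(i <- r | P i) F i) = \sum_(i <- r | P i) D (F i).
Proof.
move=> dD; apply: (big_morph D) => [u v|]; [exact: derivationD|exact: derivation0].
Qed.

Lemma derivation_det D n (M : 'M[A]_n) : derivation D ->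
  D (\det M) = \sum_i \sum_j D (M i j) * cofactor M i j.
Proof.
move=> dD; pose MD i := \matrix_(k, l) (if k == i then D (M i l) else M k l).
transitivity (\sum_i \det (MD i)); last first.
  apply: eq_bigr => i _; rewrite (expand_det_row (MD i) i).
  apply: eq_bigr => j _; rewrite mxE eqxx; congr (_ * _).
  rewrite /cofactor; congr (_ * \det _); apply/matrixP=> k l; rewrite !mxE.
  by rewrite eq_sym (negbTE (neq_lift i k)).
have Dprod (I : eqType) (r : seq I) (F : I -> A) : uniq r ->
    D (\prod_(k <- r) F k)
    = \sum_(i <- r) \prod_(k <- r) (if k == i then D (F k) else F k).
  elim: r => [|k r IH] /=; first by rewrite !big_nil derivation1.
  case/andP=> kr ur; rewrite !big_cons dD.2 eqxx; congr (_ * _ + _).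
    by apply: eq_big_seq => i ir; case: eqP => // ik; rewrite -ik ir in kr.
  rewrite IH // mulr_sumr; apply: eq_big_seq => i ir; rewrite big_cons.
  by case: eqP => // ki; rewrite ki ir in kr.
rewrite {1}/determinant (derivation_sum _ _ _ dD) exchange_big.
apply: eq_bigr => s _ /=.
have -> u : D ((-1) ^+ s * u) = (-1) ^+ s * D u.
  by case: (s : bool); rewrite ?expr1 ?expr0 ?mul1r // !mulN1r derivationN.
rewrite Dprod ?index_enum_uniq // mulr_sumr; apply: eq_bigr => i _.
congr (_ * _); apply: eq_bigr => k _; rewrite mxE.
by case: eqP => // ->.
Qed.

End PoissonAlgebras.

Notation OM K n := {mpoly K[n * n]}.

Section Matrices.
Variables (K : fieldType) (n : nat).
Implicit Types (f g h : OM K n) (p q r : 'I_n * 'I_n).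

Definition xvar (i j : 'I_n) : OM K n := 'X_(mxvec_index i j).

Definition xmx : 'M[OM K n]_n := \matrix_(i, j) xvar i j.

Definition cM (i : nat) : OM K n :=
  \sum_(S : {set 'I_n} | #|S| == i)
    \det (\matrix_(a < #|S|, b < #|S|) xmx (enum_val a) (enum_val b)).

(* The prescribed values {x_ij, x_kl}; xbr antisymmetrizes them, since the
   cases of xbr_half exclude those with (i, j) and (k, l) exchanged. *)
Definition xbr_half (i j k l : 'I_n) : OM K n :=
  if (i < k)%N && (j < l)%N then 2%:R * (xvar i l * xvar k j)
  else if (i == k) && (j < l)%N || (j == l) && (i < k)%N
  then xvar i j * xvar k l
  else 0.

Definition xbr (i j k l : 'I_n) : OM K n := xbr_half i j k l - xbr_half k l i j.

Definition brM f g : OM K n :=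
  \sum_(p : 'I_n * 'I_n) \sum_(q : 'I_n * 'I_n)
    f^`M(mxvec_index p.1 p.2) * g^`M(mxvec_index q.1 q.2)
    * xbr p.1 p.2 q.1 q.2.

Definition ord_sgn (a b : 'I_n) : K := (a < b)%N%:R - (b < a)%N%:R.

Lemma xbrE i j k l :
  xbr i j k l = (ord_sgn i k + ord_sgn j l) *: (xvar i l * xvar k j).
Proof.
rewrite /xbr /xbr_half /ord_sgn -!(inj_eq val_inj) /=.
case: (ltngtP i k) => [ik|ki|/val_inj ik]; case: (ltngtP j l) => [jl|lj|/val_inj jl];
  rewrite /= ?subr0 ?sub0r ?subrr ?addrN ?addNr ?scale0r ?subr0 ?add0r ?addr0 ?scale1r
    ?scaleN1r -?opprD ?scaleNr ?scalerDl ?scale1r //; subst;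
  rewrite /= ?subrr ?scale0r //; ring.
Qed.

Lemma derivation_ext (D D' : OM K n -> OM K n) :
  derivation D -> derivation D' ->
  (forall i j, D (xvar i j) = D' (xvar i j)) -> D =1 D'.
Proof.
move=> dD dD' eqx f; rewrite [f]mpolyE !derivation_sum //.
apply: eq_bigr => m _; rewrite !derivationZ //; congr (_ *: _).
have P1 : D 1 = D' 1 by rewrite !derivation1.
have PM u v : D u = D' u -> D v = D' v -> D (u * v) = D' (u * v).
  by move=> Du Dv; rewrite dD.2 dD'.2 Du Dv.
rewrite mpolyXE_id; apply: (big_ind (fun u => D u = D' u)) => // a _.
have Pa : D 'X_a = D' 'X_a by case/mxvec_indexP: a => i j; apply: eqx.
by elim: (m a) => [|e IH]; rewrite ?expr0 // exprS; apply: PM.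
Qed.

Lemma brM_derivation f : derivation (brM f).
Proof.
split=> [k g h|g h]; rewrite /brM.
  rewrite scaler_sumr -big_split; apply: eq_bigr => p _ /=.
  rewrite scaler_sumr -big_split; apply: eq_bigr => q _ /=.
  by rewrite mderivD mderivZ [_ * (k *: _ + _)]mulrDr mulrDl -scalerAr -scalerAl.
rewrite mulr_suml mulr_sumr -big_split; apply: eq_bigr => p _ /=.
rewrite mulr_suml mulr_sumr -big_split; apply: eq_bigr => q _ /=.
by rewrite mderivM; ring.
Qed.

Lemma brM_antisym f g : brM f g = - brM g f.
Proof.
rewrite /brM exchange_big -sumrN; apply: eq_bigr => q _ /=.
rewrite -sumrN; apply: eq_bigr => p _ /=.
by rewrite /xbr; ring.
Qed.

Lemma brM_gen i j k l : brM (xvar i j) (xvar k l) = xbr i j k l.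
Proof.
have dX i1 j1 i2 j2 : (xvar i1 j1)^`M(mxvec_index i2 j2) =
    ((i1, j1) == (i2, j2))%:R.
  rewrite /xvar mderivX mnm1E.
  have -> : (mxvec_index i1 j1 == mxvec_index i2 j2) = ((i1, j1) == (i2, j2)).
    by rewrite /mxvec_index (inj_eq (@cast_ord_inj _ _ _)) (inj_eq enum_rank_inj).
  case: eqP => [[-> ->]|_]; last by rewrite scale0r.
  have -> : (U_(mxvec_index i2 j2) - U_(mxvec_index i2 j2) = 0)%MM.
    by apply/mnmP=> a; rewrite mnmBE mnm0E subnn.
  by rewrite scale1r mpolyX0.
rewrite /brM (@big_only1 _ _ _ _ (i, j)) // => [|p /negbTE np _]; last first.
  by rewrite big1 // => q _; rewrite dX -surjective_pairing eq_sym np !mul0r.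
rewrite (@big_only1 _ _ _ _ (k, l)) // => [|q /negbTE nq _]; last first.
  by rewrite (dX k) -surjective_pairing eq_sym nq mulr0 !mul0r.
by rewrite !dX !eqxx !mul1r.
Qed.

Lemma brM_gen_lt (i j k l : 'I_n) : (i < k)%N -> (j < l)%N ->
  brM (xvar i j) (xvar k l) = 2%:R * (xvar i l * xvar k j).
Proof.
move=> ik jl; rewrite brM_gen /xbr /xbr_half ik jl /= !(ltnNge k, ltnNge l).
by rewrite !(ltnW ik, ltnW jl) /= !andbF /= subr0.
Qed.

Lemma brM_gen_row (i j l : 'I_n) : (j < l)%N ->
  brM (xvar i j) (xvar i l) = xvar i j * xvar i l.
Proof.
move=> jl; rewrite brM_gen /xbr /xbr_half jl ltnn eqxx /= (ltnNge l) (ltnW jl) /=.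
by rewrite !andbF /= subr0.
Qed.

Lemma brM_gen_col (i j k : 'I_n) : (i < k)%N ->
  brM (xvar i j) (xvar k j) = xvar i j * xvar k j.
Proof.
move=> ik; rewrite brM_gen /xbr /xbr_half ik ltnn eqxx /= andbF /=.
by rewrite (ltnNge k) (ltnW ik) /= andbF /= subr0.
Qed.

Lemma brM_gen_gt (i j k l : 'I_n) : (i < k)%N -> (l < j)%N ->
  brM (xvar i j) (xvar k l) = 0.
Proof.
move=> ik lj; rewrite brM_gen xbrE /ord_sgn ik lj (ltnNge k) (ltnNge j).
by rewrite (ltnW ik) (ltnW lj) /= subr0 sub0r subrr scale0r.
Qed.

Let jac f g h := brM f (brM g h) + brM g (brM h f) + brM h (brM f g).

Let jac_derivation f g : derivation (jac f g).
Proof.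
have dr u := brM_derivation u.
have jacE h : jac f g h = brM f (brM g h) - brM g (brM f h) - brM (brM f g) h.
  rewrite /jac [brM h f]brM_antisym [brM h (brM f g)]brM_antisym.
  by rewrite (derivationN _ (dr g)).
have lin (k : K) (a b c d e h : OM K n) :
    k *: a + b - (k *: c + d) - (k *: e + h) = k *: (a - c - e) + (b - d - h).
  by rewrite !scalerBr; ring.
have lei (u v fu fv gu gv fgu fgv hu hv gfu gfv : OM K n) :
    fgu * v + gu * fv + (fu * gv + u * fgv)
      - (gfu * v + fu * gv + (gu * fv + u * gfv)) - (hu * v + u * hv)
    = (fgu - gfu - hu) * v + u * (fgv - gfv - hv) by ring.
split=> [k u v|u v]; rewrite !jacE; first by rewrite !(dr _).1 lin.
by rewrite !(dr _).2 !(derivationD _ _ (dr _)) !(dr _).2 lei.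
Qed.

Let jac_gen i j k l s t : jac (xvar i j) (xvar k l) (xvar s t) = 0.
Proof.
rewrite /jac !brM_gen !xbrE !(derivationZ _ _ (brM_derivation _)).
rewrite !(brM_derivation _).2 !brM_gen !xbrE.
have sgnV a b : ord_sgn b a = - ord_sgn a b by rewrite /ord_sgn opprB.
rewrite (sgnV i s) (sgnV j t) (sgnV i k) (sgnV j l) (sgnV k s) (sgnV l t).
rewrite -!mul_mpolyC !(rmorphD, rmorphN) /=.
set M := xvar i t * xvar k j * xvar s l; set M' := xvar i l * xvar k t * xvar s j.
pose S a b c : K := ord_sgn a b * ord_sgn b c - ord_sgn b c * ord_sgn a c
  - ord_sgn a c * ord_sgn a b.
have SE a b c : S a b c = - (~~ ((a == b) && (b == c)))%:R.
  rewrite /S /ord_sgn -!(inj_eq val_inj) /=.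
  move: (val a) (val b) (val c) => x y z.
  case: (ltngtP x y) => ?; case: (ltngtP y z) => ?; case: (ltngtP x z) => ? //=;
    by [ring | exfalso; lia].
transitivity ((S i k s - S j l t)%:MP * (M - M')).
  rewrite /S /M /M' !(rmorphB, rmorphM) /=; ring.
rewrite !SE /M /M' {M M' SE S}.
have [/andP[/eqP <- /eqP <-]|nr] := boolP ((i == k) && (k == s)).
  by ring.
have [/andP[/eqP <- /eqP <-]|nc] := boolP ((j == l) && (l == t)).
  by ring.
by rewrite subrr mul0r.
Qed.

Lemma brM_poisson : poisson_bracket_axioms brM.
Proof.
have dr u := brM_derivation u.
split=> [f|f g|f g h|f g h]; [exact: (dr f).1|exact: brM_antisym|exact: (dr f).2|].
have d0 : derivation (fun _ : OM K n => 0 : OM K n).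
  by split=> [k u v|u v]; rewrite ?scaler0 ?mul0r ?mulr0 addr0.
have jacC u v w : jac u v w = jac v w u by rewrite /jac -[LHS]addrA; exact: addrC.
apply: (derivation_ext (jac_derivation f g) d0) => s t; rewrite -/(jac f g _).
rewrite jacC jacC; apply: (derivation_ext (jac_derivation _ _) d0) => k l.
rewrite jacC jacC; apply: (derivation_ext (jac_derivation _ _) d0) => i j.
exact: jac_gen.
Qed.

Lemma brM_unique (br : OM K n -> OM K n -> OM K n) :
  poisson_bracket_axioms br ->
  (forall i j k l, br (xvar i j) (xvar k l) = xbr i j k l) ->
  forall f g, br f g = brM f g.
Proof.
move=> pbr brx f g; apply: derivation_ext; [exact: poisson_derivation|exact: brM_derivation|].
move=> k l; rewrite (poisson_antisym pbr) brM_antisym; congr (- _).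
apply: derivation_ext; [exact: poisson_derivation|exact: brM_derivation|].
by move=> i j; rewrite brx brM_gen.
Qed.

Lemma brM_det f : brM (\det xmx) f = 0.
Proof.
rewrite brM_antisym; apply/eqP; rewrite oppr_eq0; apply/eqP; move: f.
suff H i j : brM (xvar i j) (\det xmx) = 0.
  move=> f; rewrite brM_antisym; apply/eqP; rewrite oppr_eq0; apply/eqP.
  apply: (derivation_ext (D' := fun=> 0)) => [||i j]; first exact: brM_derivation.
    by split=> [k u v|u v]; rewrite ?scaler0 ?mul0r ?mulr0 addr0.
  by rewrite brM_antisym H oppr0.
rewrite derivation_det; last exact: brM_derivation.
have sgn0 a : ord_sgn a a = 0 by rewrite /ord_sgn subrr.
have row (a b : 'I_n) : \sum_l xvar a l * cofactor xmx b l = (\det xmx) *+ (a == b).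
  have := mul_mx_adj xmx => /matrixP/(_ a b); rewrite !mxE => <-.
  by apply: eq_bigr => l _; rewrite !mxE.
have col (a b : 'I_n) : \sum_k xvar k a * cofactor xmx k b = (\det xmx) *+ (b == a).
  have := mul_adj_mx xmx => /matrixP/(_ b a); rewrite !mxE => <-.
  by apply: eq_bigr => l _; rewrite !mxE mulrC.
pose F k l := ord_sgn i k *: (xvar k j * (xvar i l * cofactor xmx k l)).
pose G k l := ord_sgn j l *: (xvar i l * (xvar k j * cofactor xmx k l)).
have F0 : \sum_k \sum_l F k l = 0.
  apply: big1 => k _; rewrite /F -scaler_sumr -mulr_sumr row.
  by case: eqP => [->|_]; rewrite ?sgn0 ?scale0r // mulr0n mulr0 scaler0.
have G0 : \sum_k \sum_l G k l = 0.
  rewrite exchange_big; apply: big1 => l _; rewrite /G -scaler_sumr -mulr_sumr col.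
  by case: eqP => [->|_]; rewrite ?sgn0 ?scale0r // mulr0n mulr0 scaler0.
transitivity (\sum_k \sum_l F k l + \sum_k \sum_l G k l); last first.
  by rewrite F0 G0 addr0.
rewrite -big_split; apply: eq_bigr => k _.
rewrite -big_split; apply: eq_bigr => l _.
rewrite mxE brM_gen xbrE scalerDl mulrDl -!scalerAl /F /G.
by congr (_ *: _ + _ *: _); ring.
Qed.

Lemma meval_det : (\det xmx).@[fun a => (mxvec (1%:M : 'M[K]_n)) 0 a] = 1.
Proof.
rewrite -det_map_mx -[RHS](det1 K n); congr (\det _).
by apply/matrixP=> i j; rewrite mxE [xmx i j]mxE /= /xvar mevalXU mxvecE.
Qed.

Lemma det_neq0 : \det xmx != 0.
Proof. by apply/eqP => d0; have /eqP := meval_det; rewrite d0 meval0 eq_sym oner_eq0. Qed.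

End Matrices.

Section PrincipalMinors.
Variables (K : fieldType) (n : nat).

Let minor_cast (S : {set 'I_n}) m (e : #|S| = m) :
  \det (\matrix_(a < #|S|, b < #|S|) xmx K n (enum_val a) (enum_val b)) =
  \det (\matrix_(a < m, b < m)
    xmx K n (enum_val (cast_ord (esym e) a)) (enum_val (cast_ord (esym e) b))).
Proof.
by case: m / e; congr (\det _); apply/matrixP => a b; rewrite !mxE !cast_ord_id.
Qed.

Lemma cM1 : cM K n 1 = \tr (xmx K n).
Proof.
transitivity (\sum_(S in [set [set i]%SET | i in 'I_n]%SET)
    \det (\matrix_(a < #|S|, b < #|S|) xmx K n (enum_val a) (enum_val b))).
  apply: eq_bigl => S; apply/cards1P/imsetP => [[i ->]|[i _ ->]]; by exists i.
rewrite big_imset /= => [|i j _ _]; last exact: set1_inj.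
apply: eq_bigr => i _; rewrite (minor_cast (cards1 i)) det_mx11 mxE.
set a := cast_ord _ _; suff -> : enum_val a = i by [].
by have /set1P := enum_valP a.
Qed.

Lemma cMn : cM K n n = \det (xmx K n).
Proof.
have cT : #|[set: 'I_n]| = n by rewrite cardsT card_ord.
rewrite /cM (@big_only1 _ _ _ _ [set: 'I_n]%SET) ?cT // => [|S ST /eqP cS]; last first.
  by case/eqP: ST; apply/eqP; rewrite eqEcard finset.subsetT cT cS /=.
rewrite (minor_cast cT); pose f a := enum_val (cast_ord (esym cT) a).
have fI : injective f by move=> a b /enum_val_inj /cast_ord_inj.
transitivity (\det (row_perm (perm fI) (col_perm (perm fI) (xmx K n)))).
  by congr (\det _); apply/matrixP => a b; rewrite !mxE !permE.
rewrite row_permE col_permE !det_mulmx !det_perm odd_permV mulrCA.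
by rewrite -signr_addb addbb expr0 mulr1.
Qed.

End PrincipalMinors.

Section SpecialLinear.
Variables (K : fieldType) (n : nat).

Definition det1_ideal (f : OM K n) : bool :=
  `[< exists g, f = g * (\det (xmx K n) - 1) >].

Lemma det1_ideal_closed : idealr_closed det1_ideal.
Proof.
split=> [||f g h /asboolP[g' ->] /asboolP[h' ->]].
- by apply/asboolP; exists 0; rewrite mul0r.
- apply/asboolPn => -[g /(congr1 (meval (fun a => mxvec 1%:M 0 a)))].
  rewrite mevalM mevalB meval_det !meval1 subrr mulr0.
  by move/eqP; rewrite oner_eq0.
- by apply/asboolP; exists (f * g' + h'); rewrite mulrDl mulrA.
Qed.

HB.instance Definition _ := isIdealr.Build (OM K n) det1_ideal det1_ideal_closed.

Definition det1_idealr : idealr (OM K n) := det1_ideal.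

Definition OSL : Type := {ideal_quot det1_idealr}.

HB.instance Definition _ := GRing.ComNzRing.on OSL.

Definition piSL (f : OM K n) : OSL := \pi_({ideal_quot det1_idealr}) f.

Definition reprSL (x : OSL) : OM K n := repr (x : {ideal_quot det1_idealr}).

Lemma piSL_zmod_morphism : zmod_morphism piSL.
Proof. by move=> f g; rewrite /piSL rmorphB. Qed.

Lemma piSL_monoid_morphism : monoid_morphism piSL.
Proof. by split=> [|f g]; rewrite /piSL (rmorph1, rmorphM). Qed.

HB.instance Definition _ :=
  GRing.isZmodMorphism.Build (OM K n) OSL piSL piSL_zmod_morphism.
HB.instance Definition _ :=
  GRing.isMonoidMorphism.Build (OM K n) OSL piSL piSL_monoid_morphism.

Lemma reprSLK : cancel reprSL piSL. Proof. exact: reprK. Qed.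

Lemma piSL_eqP f g :
  piSL f = piSL g <-> exists h, f - g = h * (\det (xmx K n) - 1).
Proof.
split=> [/eqP|H].
  by rewrite /piSL -Quotient.idealrBE => /asboolP.
by apply/eqP; rewrite /piSL -Quotient.idealrBE; apply/asboolP.
Qed.

Definition scaleSL (k : K) (x : OSL) : OSL := piSL k%:MP * x.

Fact scaleSLA k l x : scaleSL k (scaleSL l x) = scaleSL (k * l) x.
Proof. by rewrite /scaleSL mulrA -rmorphM -mpolyCM. Qed.

Fact scaleSL1 : left_id 1 scaleSL.
Proof. by move=> x; rewrite /scaleSL mpolyC1 rmorph1 mul1r. Qed.

Fact scaleSLDr : right_distributive scaleSL +%R.
Proof. by move=> k x y; rewrite /scaleSL mulrDr. Qed.

Fact scaleSLDl x : {morph scaleSL^~ x : k l / k + l}.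
Proof. by move=> k l; rewrite /scaleSL mpolyCD rmorphD mulrDl. Qed.

HB.instance Definition _ := GRing.Zmodule_isLmodule.Build K OSL
  scaleSLA scaleSL1 scaleSLDr scaleSLDl.

Fact scaleSLAl k (x y : OSL) : k *: (x * y) = k *: x * y.
Proof. exact: mulrA. Qed.

HB.instance Definition _ := GRing.Lmodule_isLalgebra.Build K OSL scaleSLAl.
HB.instance Definition _ := GRing.Lalgebra_isComAlgebra.Build K OSL.

Lemma piSLZ k f : piSL (k *: f) = k *: piSL f.
Proof. by rewrite -mul_mpolyC rmorphM. Qed.

Definition cSL (i : nat) : OSL := piSL (cM K n i).

(* Independent of the representatives, det being Poisson-central: see brSL_pi. *)
Definition brSL (x y : OSL) : OSL := piSL (brM (reprSL x) (reprSL y)).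

Lemma brSL_pi f g : brSL (piSL f) (piSL g) = piSL (brM f g).
Proof.
have brN f1 f2 h : brM f1 h - brM f2 h = brM (f1 - f2) h.
  rewrite [RHS]brM_antisym (derivationD _ _ (brM_derivation h)).
  by rewrite (derivationN _ (brM_derivation h)) opprD opprK -!brM_antisym.
have det1 h : brM h (\det (xmx K n) - 1) = 0.
  rewrite (derivationD _ _ (brM_derivation h)) (derivationN _ (brM_derivation h)).
  by rewrite (derivation1 (brM_derivation h)) oppr0 addr0 brM_antisym brM_det oppr0.
have wd f1 f2 h : piSL f1 = piSL f2 -> piSL (brM h f1) = piSL (brM h f2).
  case/piSL_eqP=> u uE; apply/piSL_eqP; exists (brM h u).
  rewrite -(derivationN _ (brM_derivation h)) -(derivationD _ _ (brM_derivation h)).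
  by rewrite uE (brM_derivation h).2 det1 mulr0 addr0.
rewrite /brSL (wd _ g) ?reprSLK //.
rewrite brM_antisym [in RHS]brM_antisym !rmorphN; congr (- _).
by apply: wd; rewrite reprSLK.
Qed.

Lemma brSL_poisson : poisson_bracket_axioms brSL.
Proof.
have P := brM_poisson K n.
have piE x : exists f, x = piSL f by exists (reprSL x); rewrite reprSLK.
split=> [x k y z|x y|x y z|x y z]; have [f ->] := piE x; have [g ->] := piE y;
  try have [h ->] := piE z.
- rewrite -piSLZ -rmorphD !brSL_pi (poisson_linear P) rmorphD /=.
  by rewrite piSLZ.
- by rewrite !brSL_pi (poisson_antisym P) rmorphN.
- by rewrite -rmorphM !brSL_pi (poisson_leibniz P) rmorphD !rmorphM.
- by rewrite !brSL_pi -!rmorphD (poisson_jacobi P) rmorph0.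
Qed.

End SpecialLinear.

Section GeneralLinear.
Variables (K : fieldType) (n : nat).

Local Notation det := (\det (xmx K n)).
Local Notation detF := (tofrac det).

Definition in_GL (u : {fraction OM K n}) : bool :=
  `[< exists (f : OM K n) (k : nat), u = tofrac f / detF ^+ k >].

Let detF_neq0 k : detF ^+ k != 0.
Proof. by rewrite expf_neq0 // tofrac_eq0 det_neq0. Qed.

Lemma in_GL_frac f k : in_GL (tofrac f / detF ^+ k).
Proof. by apply/asboolP; exists f, k. Qed.

Lemma in_GL_subring : subring_closed in_GL.
Proof.
split=> [|u v /asboolP[f [k ->]] /asboolP[g [l ->]]|
  u v /asboolP[f [k ->]] /asboolP[g [l ->]]]; apply/asboolP.
- by exists 1, 0%N; rewrite tofrac1 expr0 divr1.
- exists (f * det ^+ l - g * det ^+ k), (k + l)%N.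
  rewrite -mulNr addf_div ?detF_neq0 // exprD rmorphB !rmorphM !rmorphXn.
  by rewrite mulNr.
- exists (f * g), (k + l)%N; rewrite rmorphM exprD.
  by rewrite invfM mulrACA.
Qed.

HB.instance Definition _ :=
  GRing.isSubringClosed.Build {fraction OM K n} in_GL in_GL_subring.

Record OGL : Type := MkOGL { GLval : {fraction OM K n}; GLvalP : in_GL GLval }.

HB.instance Definition _ := [isSub for GLval].
HB.instance Definition _ := [Choice of OGL by <:].
HB.instance Definition _ := [SubChoice_isSubComNzRing of OGL by <:].

Definition fracGL (f : OM K n) (k : nat) : OGL := MkOGL (in_GL_frac f k).

Definition iotaGL (f : OM K n) : OGL := fracGL f 0.

Lemma fracGLP (x : OGL) : exists f k, x = fracGL f k.
Proof. by case: x => u pu; case/asboolP: (pu) => f [k E]; exists f, k; apply: val_inj. Qed.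

Lemma fracGL_eq f k g l : fracGL f k = fracGL g l <-> f * det ^+ l = g * det ^+ k.
Proof.
have E : (fracGL f k == fracGL g l) = (f * det ^+ l == g * det ^+ k).
  by rewrite -val_eqE /= eqr_div ?detF_neq0 // -!rmorphXn -!rmorphM /= tofrac_eq.
by split=> /eqP; [rewrite E | rewrite -E] => /eqP.
Qed.

Lemma fracGLD f g k : fracGL f k + fracGL g k = fracGL (f + g) k.
Proof. by apply: val_inj; rewrite /= rmorphD mulrDl. Qed.

Lemma fracGLM f g k l : fracGL f k * fracGL g l = fracGL (f * g) (k + l).
Proof. by apply: val_inj; rewrite /= rmorphM exprD invfM mulrACA. Qed.

Lemma fracGLX f k m : fracGL f k = fracGL (f * det ^+ m) (k + m).
Proof. by apply/fracGL_eq; rewrite exprD mulrAC mulrA. Qed.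

Lemma iotaGL_zmod_morphism : zmod_morphism iotaGL.
Proof. by move=> f g; apply: val_inj; rewrite /= rmorphB mulrBl. Qed.

Lemma iotaGL_monoid_morphism : monoid_morphism iotaGL.
Proof.
split=> [|f g]; last by rewrite /iotaGL fracGLM.
by apply: val_inj; rewrite /= expr0 divr1 tofrac1.
Qed.

HB.instance Definition _ :=
  GRing.isZmodMorphism.Build (OM K n) OGL iotaGL iotaGL_zmod_morphism.
HB.instance Definition _ :=
  GRing.isMonoidMorphism.Build (OM K n) OGL iotaGL iotaGL_monoid_morphism.

Definition unitGL (x : OGL) : bool := `[< exists y : OGL, y * x = 1 >].

Definition invGL (x : OGL) : OGL :=
  if pselect (exists y : OGL, y * x = 1) is left e then projT1 (cid e) else x.

Fact mulVGL : {in unitGL, left_inverse 1 invGL *%R}.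
Proof.
move=> x /asboolP ex; rewrite /invGL; case: pselect => // e.
exact: (projT2 (cid e)).
Qed.

Fact unitGLPl x y : y * x = 1 -> unitGL x.
Proof. by move=> yx; apply/asboolP; exists y. Qed.

Fact invGL_out : {in [predC unitGL], invGL =1 id}.
Proof. by move=> x /asboolPn nx; rewrite /invGL; case: pselect. Qed.

HB.instance Definition _ :=
  GRing.ComNzRing_hasMulInverse.Build OGL mulVGL unitGLPl invGL_out.

Definition scaleGL (k : K) (x : OGL) : OGL := iotaGL k%:MP * x.

Fact scaleGLA k l x : scaleGL k (scaleGL l x) = scaleGL (k * l) x.
Proof. by rewrite /scaleGL mulrA -rmorphM -mpolyCM. Qed.

Fact scaleGL1 : left_id 1 scaleGL.
Proof. by move=> x; rewrite /scaleGL mpolyC1 rmorph1 mul1r. Qed.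

Fact scaleGLDr : right_distributive scaleGL +%R.
Proof. by move=> k x y; rewrite /scaleGL mulrDr. Qed.

Fact scaleGLDl x : {morph scaleGL^~ x : k l / k + l}.
Proof. by move=> k l; rewrite /scaleGL mpolyCD rmorphD mulrDl. Qed.

HB.instance Definition _ := GRing.Zmodule_isLmodule.Build K OGL
  scaleGLA scaleGL1 scaleGLDr scaleGLDl.

Fact scaleGLAl k (x y : OGL) : k *: (x * y) = k *: x * y.
Proof. exact: mulrA. Qed.

HB.instance Definition _ := GRing.Lmodule_isLalgebra.Build K OGL scaleGLAl.
HB.instance Definition _ := GRing.Lalgebra_isComAlgebra.Build K OGL.

Lemma fracGLZ a f k : a *: fracGL f k = fracGL (a *: f) k.
Proof. by rewrite -mul_mpolyC -[RHS]/(fracGL _ (0 + k)) -fracGLM. Qed.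

Definition cGL (i : nat) : OGL := iotaGL (cM K n i).

Lemma cGL_unit : cGL n \is a GRing.unit.
Proof.
apply/unitrPr; exists (fracGL 1 1).
by rewrite /cGL cMn /iotaGL fracGLM -(rmorph1 iotaGL); apply/fracGL_eq; ring.
Qed.

Lemma cGLnV : (cGL n)^-1 = fracGL 1 1.
Proof.
apply: (mulrI cGL_unit); rewrite divrr ?cGL_unit //.
by rewrite /cGL cMn /iotaGL fracGLM -(rmorph1 iotaGL); apply/fracGL_eq; ring.
Qed.

Definition fracGL_of (x : OGL) : { fk : OM K n * nat | x = fracGL fk.1 fk.2 } :=
  cid (let: ex_intro f (ex_intro k e) := fracGLP x in ex_intro _ (f, k) e).

Definition numGL (x : OGL) : OM K n := (projT1 (fracGL_of x)).1.
Definition expGL (x : OGL) : nat := (projT1 (fracGL_of x)).2.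

Lemma num_expGL x : x = fracGL (numGL x) (expGL x).
Proof. exact: (projT2 (fracGL_of x)). Qed.

(* Since det is Poisson-central, the Leibniz rule forces
   {f / det^k, g / det^l} = {f, g} / det^(k + l); see brGL_frac. *)
Definition brGL (x y : OGL) : OGL :=
  fracGL (brM (numGL x) (numGL y)) (expGL x + expGL y).

Let brM_detX f g k : brM f (g * det ^+ k) = brM f g * det ^+ k.
Proof.
have dk : brM f (det ^+ k) = 0.
  elim: k => [|k IH]; first by rewrite expr0 (derivation1 (brM_derivation f)).
  rewrite exprS (brM_derivation f).2 IH mulr0 addr0 brM_antisym brM_det.
  by rewrite oppr0 mul0r.
by rewrite (brM_derivation f).2 dk mulr0 addr0.
Qed.

Let brM_detXl f g k : brM (g * det ^+ k) f = brM g f * det ^+ k.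
Proof. by rewrite brM_antisym brM_detX -mulNr -brM_antisym. Qed.

Lemma brGL_frac f k g l :
  brGL (fracGL f k) (fracGL g l) = fracGL (brM f g) (k + l).
Proof.
rewrite /brGL; set x := fracGL f k; set y := fracGL g l.
have /fracGL_eq Ex : fracGL (numGL x) (expGL x) = fracGL f k by rewrite -num_expGL.
have /fracGL_eq Ey : fracGL (numGL y) (expGL y) = fracGL g l by rewrite -num_expGL.
apply/fracGL_eq; rewrite !exprD !mulrA -brM_detXl -brM_detX Ex Ey.
by rewrite brM_detX brM_detXl.
Qed.

Lemma brGL_iota f g : brGL (iotaGL f) (iotaGL g) = iotaGL (brM f g).
Proof. exact: brGL_frac. Qed.

Lemma brGL_poisson : poisson_bracket_axioms brGL.
Proof.
have P := brM_poisson K n.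
split=> [x a y z|x y|x y z|x y z]; have [f [k ->]] := fracGLP x;
  have [g [l ->]] := fracGLP y.
- have [h [m ->]] := fracGLP z.
  rewrite (fracGLX g l m) (fracGLX h m l) [(m + l)%N]addnC.
  by rewrite !(fracGLZ, fracGLD, brGL_frac) (poisson_linear P).
- rewrite !brGL_frac (poisson_antisym P) [(l + k)%N]addnC -scaleN1r.
  by rewrite -fracGLZ scaleN1r.
- have [h [m ->]] := fracGLP z.
  rewrite !(fracGLM, brGL_frac) (poisson_leibniz P).
  have -> : (l + (k + m))%N = (k + (l + m))%N by rewrite addnCA.
  by rewrite -addnA fracGLD.
- have [h [m ->]] := fracGLP z; rewrite !brGL_frac.
  have -> : (l + (m + k))%N = (k + (l + m))%N by rewrite addnA addnC.
  have -> : (m + (k + l))%N = (k + (l + m))%N by rewrite addnC addnA.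
  rewrite !fracGLD (poisson_jacobi P) -(rmorph0 iotaGL).
  by apply/fracGL_eq; rewrite !mul0r.
Qed.

End GeneralLinear.

(* Main.v *)
Require Import Defs.
From HB Require Import structures.
From mathcomp Require Import all_boot all_order all_algebra.
From mathcomp Require Import perm ring zify.
From mathcomp Require Import boolp classical_sets reals complex mpoly.

Set Implicit Arguments.
Unset Strict Implicit.
Unset Printing Implicit Defensive.

Import GRing.Theory.
Local Open Scope ring_scope.

(** Let X be the generic matrix, D the derivation {c_1, -} of O(M_n), and B the
    strictly upper minus the strictly lower triangular part of X.

    The bracket formula gives the Lax equation D X = X B - B X (brM_tr_lax), so
    D is a flow of Toda type.  It is isospectral, hence kills every coefficient
    c_i of det (1 + t X) (brM_tr_cM).

    Conversely let D f = 0.  Two facts show that f is a polynomial in the c_i.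

    - f is determined by its restriction p to the diagonal matrices
      (diag_res_inj).  The diagonal matrices are zeros of D, and the linear part
      of D there multiplies the coordinate x_kl, for k < l or l < k, by
      x_mm - x_MM with m = min (k, l) and M = max (k, l).  The eigenvalue on a
      monomial with off-diagonal factors is thus a sum of positive roots with
      nonnegative coefficients, not all zero, and it does not vanish.  A leading
      term argument turns this into injectivity.

    - p is a symmetric polynomial (diag_res_symmetric).  It is a root of the
      monic polynomial Q = prod_s (T - s(p)), s running over the permutations of
      the variables, whose coefficients are symmetric.  Lifting
      these coefficients to polynomials in the c_i and using injectivity, f
      becomes integral over the ring generated by the c_i
      (trace_kernel_integral).  Conjugating X by the elementary matrix 1 + t E_ij
      fixes the c_i and turns f into a polynomial in t which satisfies the same
      monic equation, so it is constant in t (conj_var_kernel).  Hence f is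
      invariant under conjugation by elementary matrices, in particular by
      signed transposition matrices, which permute the diagonal entries.

    The c_i restrict to the elementary symmetric polynomials, so the fundamental
    theorem on symmetric polynomials and injectivity identify f with a
    polynomial in the c_i (trace_kernel).

    For GL_n, a fraction f / det ^ k centralizes c_1 exactly when f does, since
    det is Poisson-central.  For SL_n, the homogeneous components of f can be
    multiplied by powers of det, which is 1 in O(SL_n), until their degrees lie
    in a window of n consecutive integers; D then maps this new representative
    into a window of n consecutive degrees, where the ideal of det - 1 has no
    nonzero element, so that D kills it (trace_kernel_mod_det). *)

(** * Sums of principal minors *)

(** The polynomial function cM evaluated at an arbitrary matrix. *)
Definition cminor (R : comPzRingType) (n i : nat) (A : 'M[R]_n) : R :=
  \sum_(S : {set 'I_n} | #|S| == i)
    \det (\matrix_(a < #|S|, b < #|S|) A (enum_val a) (enum_val b)).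

Lemma det_reindex (R : comPzRingType) m n (f : 'I_m -> 'I_n) (A : 'M[R]_n) :
  injective f -> m = n -> \det (\matrix_(i, j) A (f i) (f j)) = \det A.
Proof.
move=> fI e; case: _ / e f fI A => f fI A.
transitivity (\det (row_perm (perm fI) (col_perm (perm fI) A))).
  by congr (\det _); apply/matrixP => a b; rewrite !mxE !permE.
rewrite row_permE col_permE !det_mulmx !det_perm odd_permV mulrCA.
by rewrite -signr_addb addbb expr0 mulr1.
Qed.

(** Listing the indices of S first makes the matrix block triangular, with an
    identity block on the complement of S. *)
Lemma det_rows_id (R : comPzRingType) n (A : 'M[R]_n) (S : {set 'I_n}) :
  \det (\matrix_(i, j) if i \in S then A i j else (i == j)%:R) =
  \det (\matrix_(a < #|S|, b < #|S|) A (enum_val a) (enum_val b)).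
Proof.
set B := (X in \det X = _); set C := (X in _ = \det X).
pose f (a : 'I_(#|S| + #|~: S|)) : 'I_n :=
  match fintype.split a with inl b => enum_val b | inr b => enum_val b end.
have fl a : f (lshift _ a) = enum_val a by rewrite /f (unsplitK (inl a)).
have fr a : f (rshift _ a) = enum_val a by rewrite /f (unsplitK (inr a)).
have eS (a : 'I_#|S|) : enum_val a \in S by exact: enum_valP.
have eC (a : 'I_#|~: S|) : (enum_val a \in S) = false.
  by apply: negbTE; have := enum_valP a; rewrite inE.
have neq (a : 'I_#|S|) (b : 'I_#|~: S|) : (enum_val b == enum_val a) = false.
  by apply/eqP => e; have := eC b; rewrite e eS.
have fI : injective f.
  move=> a b; rewrite -[a]splitK -[b]splitK.
  case: (fintype.split a) => x; case: (fintype.split b) => y; rewrite /= ?fl ?fr.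
  - by move/enum_val_inj->.
  - by move/eqP; rewrite eq_sym neq.
  - by move/eqP; rewrite neq.
  - by move/enum_val_inj->.
rewrite -(det_reindex B fI); last by rewrite cardsC card_ord.
pose E := \matrix_(a < #|S|, b < #|~: S|) A (enum_val a) (enum_val b).
have -> : \matrix_(i, j) B (f i) (f j) = block_mx C E 0 1%:M.
  apply/matrixP => k l; rewrite -[k]splitK -[l]splitK.
  case: (fintype.split k) => x; case: (fintype.split l) => y;
    rewrite /= ?block_mxEul ?block_mxEur ?block_mxEdl ?block_mxEdr !mxE ?fl ?fr ?eS ?eC //.
    by rewrite neq.
  by rewrite (inj_eq enum_val_inj).
by rewrite det_ublock det1 mulr1.
Qed.

(** Each product of entries in the Leibniz formula is expanded as a sum over the
    set S of the rows in which the summand 'X *: A is chosen. *)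
Lemma det_1_add_X (R : comNzRingType) n (A : 'M[R]_n) :
  \det (1%:M + 'X *: map_mx polyC A) = \poly_(i < n.+1) cminor i A.
Proof.
rewrite poly_def.
transitivity (\sum_(S : {set 'I_n}) 'X^#|S| *
    \det (\matrix_(i, j) if i \in S then (A i j)%:P else (i == j)%:R)).
  transitivity (\sum_(s : 'S_n) \sum_(S : {set 'I_n}) (-1) ^+ s *
      ('X^#|S| * \prod_i if i \in S then (A i (s i))%:P else (i == s i)%:R)).
    apply: eq_bigr => s _.
    rewrite (eq_bigr (fun i => 'X * (A i (s i))%:P + (i == s i)%:R)); last first.
      by move=> i _; rewrite !mxE addrC.
    rewrite bigA_distr mulr_sumr; apply: eq_bigr => S _; congr (_ * _).
    rewrite -prodr_const [in RHS](big_mkcond (fun i => i \in S)) -big_split.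
    apply: eq_bigr => i _ /=.
    by case: ifP => _; rewrite ?mul1r.
  rewrite exchange_big; apply: eq_bigr => S _ /=; rewrite mulr_sumr.
  by apply: eq_bigr => s _; rewrite mulrCA; do 2!congr (_ * _); apply: eq_bigr => i _; rewrite mxE.
rewrite (partition_big (fun S : {set 'I_n} => inord #|S| : 'I_n.+1) predT) //=.
apply: eq_bigr => i _; rewrite /cminor scaler_suml.
have lt (S : {set 'I_n}) : (#|S| < n.+1)%N.
  by rewrite ltnS -[leqRHS]card_ord max_card.
apply: eq_big => [S|S /eqP e]; first by rewrite -val_eqE /= inordK.
have -> : nat_of_ord i = #|S| by rewrite -e inordK.
rewrite mulrC -mul_polyC -det_rows_id -det_map_mx; congr (\det _ * _).
by apply/matrixP => a b; rewrite !mxE; case: ifP => _ //; rewrite rmorph_nat.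
Qed.

Lemma cminor_conj (R : comNzRingType) n (A g h : 'M[R]_n) i :
  g *m h = 1%:M -> h *m g = 1%:M -> cminor i (g *m A *m h) = cminor i A.
Proof.
move=> gh hg; case: (ltnP i n.+1) => [ltin|gtin]; last first.
  rewrite /cminor !big_pred0 // => S; apply/eqP => e.
    by have := max_card S; rewrite card_ord leqNgt e gtin.
  by have := max_card S; rewrite card_ord leqNgt e gtin.
have coefE (B : 'M[R]_n) : cminor i B = (\det (1%:M + 'X *: map_mx polyC B))`_i.
  by rewrite det_1_add_X coef_poly ltin.
rewrite !coefE; congr (_`_i).
pose G := map_mx polyC g; pose H := map_mx polyC h.
have GH : G *m H = 1%:M by rewrite /G /H -map_mxM gh map_mx1.
have -> : 1%:M + 'X *: map_mx polyC (g *m A *m h) =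
    G *m (1%:M + 'X *: map_mx polyC A) *m H.
  by rewrite mulmxDr mulmx1 mulmxDl GH -scalemxAr -scalemxAl !map_mxM.
by rewrite !det_mulmx mulrAC -det_mulmx GH det1 mul1r.
Qed.

(** * The trace flow is isospectral *)

Section TraceFlow.
Variables (K : fieldType) (n : nat).
Hypothesis char0 : [pchar K] =i pred0.

Local Notation X := (xmx K n).
Local Notation D := (brM (cM K n 1)).

(** The strictly upper minus the strictly lower triangular part of X. *)
Definition flow_mx : 'M[OM K n]_n := \matrix_(i, j) (ord_sgn K i j *: xvar K i j).

Lemma brM_tr_gen (k l : 'I_n) :
  D (xvar K k l) =
  \sum_i (ord_sgn K i k + ord_sgn K i l) *: (xvar K k i * xvar K i l).
Proof.
rewrite cM1 brM_antisym (derivation_sum _ _ _ (brM_derivation _)) -sumrN.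
by apply: eq_bigr => i _; rewrite mxE -brM_antisym brM_gen xbrE mulrC.
Qed.

Lemma brM_tr_lax : map_mx D X = X *m flow_mx - flow_mx *m X.
Proof.
apply/matrixP => k l; rewrite !mxE brM_tr_gen -sumrB; apply: eq_bigr => i _.
rewrite !mxE -scalerAr -scalerAl -scalerBl addrC; congr (_ *: _).
by rewrite /ord_sgn opprB.
Qed.

Lemma natr_mpolyC_inj : injective (fun k : nat => (k%:R : K)%:MP_[n * n]).
Proof.
have lt_neq k l : (k < l)%N -> (k%:R == l%:R :> K) = false.
  move=> lt_kl; apply/negbTE; rewrite eq_sym -subr_eq0 -natrB ?(ltnW lt_kl) //.
  by rewrite ((pcharf0P K).1 char0) -lt0n subn_gt0.
move=> k l /(congr1 (mcoeff 0%MM)); rewrite !mcoeffC eqxx !mulr1 => /eqP.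
by case: (ltngtP k l) => // /lt_neq; rewrite 1?eq_sym => ->.
Qed.

(** With M = 1 + a X the Lax equation reads D M = M B - B M, so that
    D (det M) = tr (D M * adj M) = det M * tr B - det M * tr B. *)
Lemma brM_tr_det (a : K) : D (\det (1%:M + a%:MP *: X)) = 0.
Proof.
have dD := brM_derivation (cM K n 1); set M := 1%:M + _.
have DM i j : D (M i j) = (M *m flow_mx - flow_mx *m M) i j.
  have -> : M *m flow_mx - flow_mx *m M = a%:MP *: map_mx D X.
    rewrite brM_tr_lax scalerBr /M mulmxDl mulmxDr mul1mx mulmx1 -scalemxAl -scalemxAr.
    by rewrite opprD addrACA subrr add0r.
  rewrite !mxE (derivationD _ _ dD) mul_mpolyC (derivationZ _ _ dD).
  rewrite -mul_mpolyC (_ : D (_ *+ _) = 0) ?add0r //.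
  by case: eqP => _; rewrite ?(derivation1 dD) ?(derivation0 dD).
transitivity (\tr ((M *m flow_mx - flow_mx *m M) *m \adj M)).
  rewrite derivation_det //; apply: eq_bigr => i _; rewrite mxE.
  by apply: eq_bigr => j _; rewrite DM [\adj M j i]mxE.
rewrite mulmxBl raddfB /= mxtrace_mulC mulmxA mul_adj_mx -mulmxA mul_mx_adj.
by rewrite mul_scalar_mx mul_mx_scalar subrr.
Qed.

(** The polynomial in a of brM_tr_det has the D (c_k) as coefficients, and it
    vanishes at all natural numbers a. *)
Lemma brM_tr_cM i : D (cM K n i) = 0.
Proof.
have dD := brM_derivation (cM K n 1).
pose Q := \poly_(k < n.+1) D (cM K n k).
have Q0 : Q = 0.
  apply/eqP/contraT => Qn0.
  pose rs := [seq (k%:R : K)%:MP_[n * n] | k <- iota 0 n.+1].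
  have urs : uniq rs by rewrite (map_inj_uniq natr_mpolyC_inj) iota_uniq.
  suff ars : all (root Q) rs.
    by have := max_poly_roots Qn0 ars urs; rewrite size_map size_iota ltnNge size_poly.
  apply/allP => _ /mapP[a _ ->]; rewrite /root -(brM_tr_det a%:R).
  have -> : 1%:M + (a%:R : K)%:MP *: X =
      map_mx (horner_eval (a%:R : K)%:MP) (1%:M + 'X *: map_mx polyC X).
    apply/matrixP => k l; rewrite !mxE horner_evalE hornerD hornerM hornerX hornerC.
    by rewrite hornerMn hornerC.
  rewrite det_map_mx det_1_add_X /= /horner_eval !horner_poly (derivation_sum _ _ _ dD).
  apply/eqP/eq_bigr => k _; rewrite -rmorphXn mulrC /= mul_mpolyC.
  by rewrite [in RHS]mulrC mul_mpolyC (derivationZ _ _ dD).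
case: (ltnP i n.+1) => [ltin|gtin].
  by have := congr1 (fun p : {poly _} => p`_i) Q0; rewrite coef_poly ltin coef0.
rewrite [cM K n i]big_pred0 ?(derivation0 dD) // => S; apply/eqP => e.
by have := max_card S; rewrite card_ord leqNgt e gtin.
Qed.

End TraceFlow.

(** * Evaluation at a matrix *)

Section MatrixEvaluation.
Variables (K : fieldType) (n : nat).

Definition eval_mx (T : comNzRingType) (c : {rmorphism K -> T}) (A : 'M[T]_n) :
  OM K n -> T := mmap c (fun a => mxvec A 0 a).

HB.instance Definition _ T c A := GRing.RMorphism.copy (@eval_mx T c A) (mmap c _).

Lemma eval_mxC T c A k : @eval_mx T c A k%:MP = c k.
Proof. exact: mmapC. Qed.

Lemma eval_mx_var T c A i j : @eval_mx T c A (xvar K i j) = A i j.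
Proof. by rewrite /eval_mx mmapX mmap1U mxvecE. Qed.

Lemma eval_mx_xmx T c A : map_mx (@eval_mx T c A) (xmx K n) = A.
Proof. by apply/matrixP => i j; rewrite !mxE eval_mx_var. Qed.

Lemma eval_mx_cM T c A i : @eval_mx T c A (cM K n i) = cminor i A.
Proof.
rewrite rmorph_sum; apply: eq_bigr => S _; rewrite -det_map_mx; congr (\det _).
by apply/matrixP => a b; rewrite !mxE; exact: eval_mx_var.
Qed.

Lemma eval_mx_uniq (T : comNzRingType) (f g : {rmorphism OM K n -> T}) :
  (forall k, f k%:MP = g k%:MP) -> (forall i j, f (xvar K i j) = g (xvar K i j)) ->
  f =1 g.
Proof.
move=> eqC eqx p; rewrite [p]mpolyE !rmorph_sum; apply: eq_bigr => m _.
rewrite -mul_mpolyC !rmorphM eqC mpolyXE_id !rmorph_prod; congr (_ * _).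
apply: eq_bigr => a _; rewrite !rmorphXn; congr (_ ^+ _).
by case/mxvec_indexP: a => i j; apply: eqx.
Qed.

End MatrixEvaluation.
Arguments eval_mx {K n T} c A _.

(** * Restriction to the diagonal matrices *)

Section DiagonalRestriction.
Variables (K : fieldType) (n : nat).
Implicit Types (m : 'X_{1..n * n}) (mu : 'X_{1..n}).

Local Notation ix q := (mxvec_index q.1 q.2).

Definition diag_res : OM K n -> {mpoly K[n]} :=
  eval_mx (@mpolyC n K) (diag_mx (\row_i 'X_i)).

HB.instance Definition _ := GRing.RMorphism.copy diag_res
  (eval_mx (@mpolyC n K) (diag_mx (\row_i 'X_i))).

(** The exponent of the monomial in the diagonal variables x_ii that restricts to mu. *)
Definition diag_mnm mu : 'X_{1..n * n} :=
  [multinom mxvec (\matrix_(i, j) if i == j then mu i else 0%N) 0%R a | a < n * n].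

Lemma diag_mnmE mu i j : diag_mnm mu (mxvec_index i j) = if i == j then mu i else 0%N.
Proof. by rewrite mnmE mxvecE mxE. Qed.

Lemma diag_resX m :
  diag_res 'X_[m] = if [forall q : 'I_n * 'I_n, (q.1 != q.2) ==> (m (ix q) == 0%N)]
    then 'X_[[multinom m (mxvec_index i i) | i < n]] else 0.
Proof.
have -> : diag_res 'X_[m] =
    \prod_i \prod_j diag_mx (\row_k 'X_k) i j ^+ m (mxvec_index i j) :> {mpoly K[n]}.
  rewrite [LHS]mmapX /mmap1 pair_bigA /=.
  rewrite (reindex _ (curry_mxvec_bij _ _)) /=; apply: eq_bigr => -[i j] _ /=.
  by rewrite mxvecE.
case: forallP => [m_diag|m_off].
  rewrite mpolyXE_id; apply: eq_bigr => i _; rewrite (bigD1 i) //= big1 ?mulr1.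
    by rewrite !mxE eqxx mulr1n mnmE.
  move=> j ne_ji; have /implyP/(_ _)/eqP := m_diag (i, j).
  by rewrite /= eq_sym => ->.
have [[i j] /=] : exists q : 'I_n * 'I_n, ~~ ((q.1 != q.2) ==> (m (ix q) == 0%N)).
  by apply/existsP; rewrite -negb_forall; apply/forallP.
rewrite negb_imply => /andP[/negbTE ne_ij m_ij].
by rewrite (bigD1 i) //= (bigD1 j) //= !mxE ne_ij mulr0n expr0n (negbTE m_ij) !mul0r.
Qed.

Lemma mcoeff_diag_res f mu : (diag_res f)@_mu = f@_(diag_mnm mu).
Proof.
rewrite {1}[f]mpolyE rmorph_sum [in RHS](mpolyE f) !raddf_sum /=.
apply: eq_bigr => m _; rewrite -mul_mpolyC rmorphM /= {1}/diag_res eval_mxC.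
rewrite !mcoeffCM diag_resX mcoeffX; congr (_ * _).
case: forallP => [m_diag|m_off]; last first.
  rewrite mcoeff0; case: eqP => // e; case: m_off => -[i j] /=; apply/implyP => ne_ij.
  by rewrite e diag_mnmE (negbTE ne_ij).
rewrite mcoeffX; congr (_ : bool)%:R; apply/eqP/eqP => [<-|->].
  apply/mnmP => a; case/mxvec_indexP: a => i j; rewrite diag_mnmE mnmE.
  by case: (eqVneq i j) => [<- //|ne]; have /implyP/(_ ne)/eqP := m_diag (i, j).
by apply/mnmP => i; rewrite mnmE diag_mnmE eqxx.
Qed.

(** The restriction keeps the coefficients of the monomials in the diagonal
    variables alone, so none of these occurs in a polynomial that restricts to 0. *)
Lemma diag_res_eq0 f m : diag_res f = 0 -> m \in msupp f ->
  exists2 q : 'I_n * 'I_n, q.1 != q.2 & (0 < m (ix q))%N.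
Proof.
move=> f0 mf; apply/exists_inP; apply: contraTT mf; rewrite negb_exists_in => /forall_inP m_diag.
pose mu := [multinom m (mxvec_index i i) | i < n].
suff -> : m = diag_mnm mu by rewrite mcoeff_msupp -mcoeff_diag_res f0 mcoeff0 eqxx.
apply/mnmP => a; case/mxvec_indexP: a => i j; rewrite diag_mnmE mnmE.
by case: (eqVneq i j) => [<- //|ne]; have := m_diag (i, j) ne; rewrite -eqn0Ngt => /eqP.
Qed.

Lemma diag_res_cM i : diag_res (cM K n i) = mesym n K i.
Proof.
rewrite [LHS]eval_mx_cM; apply: eq_bigr => S _.
rewrite (_ : (\matrix_(a, b) _) = diag_mx (\row_a 'X_(enum_val a))).
  rewrite det_diag [RHS]big_enum_val; apply: eq_bigr => a _; by rewrite mxE.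
by apply/matrixP => a b; rewrite !mxE (inj_eq enum_val_inj).
Qed.

End DiagonalRestriction.

(** * A kernel element is determined by its diagonal restriction *)

Section Injectivity.
Variables (K : fieldType) (n : nat).
Hypothesis char0 : [pchar K] =i pred0.
Implicit Types (m : 'X_{1..n * n}) (q : 'I_n * 'I_n).

Local Notation D := (brM (cM K n 1)).
Local Notation ix q := (mxvec_index q.1 q.2).
Local Notation off q := (q.1 != q.2).

Lemma mxvec_index_eq (i j k l : 'I_n) :
  (mxvec_index i j == mxvec_index k l) = ((i, j) == (k, l)).
Proof. by rewrite /mxvec_index (inj_eq (@cast_ord_inj _ _ _)) (inj_eq enum_rank_inj). Qed.

Lemma derivation_mderiv (D' : OM K n -> OM K n) f : derivation D' ->
  D' f = \sum_q f^`M(ix q) * D' (xvar K q.1 q.2).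
Proof.
move=> dD; move: f; apply: (derivation_ext dD) => [|i j].
  split=> [k f g|f g].
    rewrite scaler_sumr -big_split; apply: eq_bigr => q _ /=.
    by rewrite mderivD mderivZ mulrDl -scalerAl.
  rewrite mulr_suml mulr_sumr -big_split; apply: eq_bigr => q _ /=.
  by rewrite mderivM mulrDl mulrA mulrAC.
rewrite (bigD1 (i, j)) //= big1 ?addr0.
  rewrite /xvar mderivX mnm1E eqxx scale1r.
  by rewrite (_ : (_ - _)%MM = 0%MM) ?mpolyX0 ?mul1r //; apply/mnmP => a; rewrite mnmBE subnn mnm0E.
move=> [k l] ne; rewrite /xvar mderivX mnm1E mxvec_index_eq eq_sym (negbTE ne).
by rewrite scale0r mul0r.
Qed.

(** The degree in which the diagonal variable x_kk has weight n - k, for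
    0 <= k < n, and the off-diagonal variables have weight 0: the diagonal
    weights are positive and strictly decreasing. *)
Definition diag_wt m := (\sum_k m (mxvec_index k k) * (n - k))%N.

(** The amount by which D raises diag_wt on a monomial with off-diagonal factors:
    the weight of x_kk, for the least index k of a row or column of such a
    factor. *)
Definition off_wt m := (\max_(q | off q && (0 < m (ix q))) (n - minn q.1 q.2))%N.

Lemma diag_wtD m1 m2 : diag_wt (m1 + m2)%MM = (diag_wt m1 + diag_wt m2)%N.
Proof.
by rewrite /diag_wt -big_split; apply: eq_bigr => k _; rewrite mnmDE mulnDl.
Qed.

Lemma diag_wt1 (i j : 'I_n) : diag_wt U_(mxvec_index i j) = if i == j then (n - i)%N else 0%N.
Proof.
rewrite /diag_wt (bigD1 i) //= mnm1E mxvec_index_eq xpair_eqE eqxx eq_sym /= big1 ?addn0.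
  by case: eqP => _; rewrite ?mul1n ?mul0n.
by move=> k ne; rewrite mnm1E mxvec_index_eq xpair_eqE eq_sym (negbTE ne).
Qed.

Lemma off_wt_diag m (k : 'I_n) : off_wt (m + U_(mxvec_index k k))%MM = off_wt m.
Proof.
apply: eq_bigl => -[i j] /=; case: eqP => //= ne; rewrite mnmDE mnm1E.
rewrite mxvec_index_eq (_ : _ == _ = false) ?addn0 //.
by apply/eqP => -[e1 e2]; case: ne; rewrite -e1 -e2.
Qed.

Lemma off_wt_ge m q : off q -> (0 < m (ix q))%N -> (n - minn q.1 q.2 <= off_wt m)%N.
Proof.
move=> oq mq; pose F q := (n - minn q.1 q.2)%N.
by apply: (@leq_bigmax_cond _ (fun q => off q && (0 < m (ix q))%N) F); rewrite oq.
Qed.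

Lemma subn_ord_inj : injective (fun k : 'I_n => (n - k)%N).
Proof.
move=> i j e; apply: val_inj => /=.
by rewrite -(subKn (ltnW (ltn_ord i))) e subKn // ltnW.
Qed.

(** In D 'X_[m] the variable q and the index i contribute the monomial on the left
    of the last hypothesis, see brM_tr_X.  If diag_wt + off_wt is not larger at m
    than at m0, then this can be the top monomial m0 * x_kk only when m is m0 and
    D is applied to an off-diagonal factor in row or column k.  Indeed D of a
    diagonal variable lowers diag_wt, and D x_ab raises it by the weight of x_aa
    or x_bb, or not at all; and when the weight is reached, off_wt
    identifies k, hence m0. *)
Lemma top_monomial m0 m (k i : 'I_n) q :
  off_wt m0 = (n - k)%N ->
  (diag_wt m + off_wt m <= diag_wt m0 + off_wt m0)%N ->
  (0 < m (ix q))%N -> ord_sgn K i q.1 + ord_sgn K i q.2 != 0 ->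
  (m - U_(ix q) + (U_(mxvec_index q.1 i) + U_(mxvec_index i q.2)) =
    m0 + U_(mxvec_index k k))%MM ->
  [/\ m = m0, off q, minn q.1 q.2 = k :> nat & i = k].
Proof.
case: q => a b /= ok le_m mq sgn0 e.
have e' : (m + (U_(mxvec_index a i) + U_(mxvec_index i b)) =
    m0 + U_(mxvec_index k k) + U_(mxvec_index a b))%MM.
  have := submK (_ : (U_(mxvec_index a b) <= m)%MM); rewrite lep1mP -lt0n mq => /(_ isT) {1}<-.
  by rewrite -e -!addmA; congr (_ + _)%MM; rewrite addmC -addmA.
have := congr1 diag_wt e'; rewrite !diag_wtD !diag_wt1 eqxx -ok.
have sgnaa x : ord_sgn K x x = 0 by rewrite /ord_sgn subrr.
have lt0 (x : 'I_n) : (0 < n - x)%N by rewrite subn_gt0.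
case: (eqVneq a b) => [ab|ne_ab].
  subst b; have ne_ai : a != i.
    by apply: contraNneq sgn0 => ->; rewrite sgnaa addr0.
  by rewrite (negbTE ne_ai) eq_sym (negbTE ne_ai); have := lt0 a; lia.
have := off_wt_ge (q := (a, b)) ne_ab mq => /= gem.
have gea : (n - a <= n - minn a b)%N by rewrite leq_sub2l // geq_minl.
have geb : (n - b <= n - minn a b)%N by rewrite leq_sub2l // geq_minr.
have fin : i = a \/ i = b -> (n - i = off_wt m)%N ->
    (m + U_(mxvec_index i i) = m0 + U_(mxvec_index k k))%MM ->
    [/\ m = m0, true, minn a b = k :> nat & i = k].
  move=> iab Vi em; have ik : i = k.
    apply: subn_ord_inj; rewrite /= -ok Vi -(off_wt_diag m i) em.
    by rewrite off_wt_diag.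
  split=> //; first by subst i; apply: addIm em.
  have ltm : (minn a b < n)%N by rewrite gtn_min ltn_ord.
  have Vle : (n - minn a b <= n - i)%N by rewrite Vi.
  have ltn_i := ltn_ord i; rewrite -ik.
  by case: iab => /(congr1 val) /= ei; lia.
case: (eqVneq a i) => [ai|ne_ai]; case: (eqVneq i b) => [ib|ne_ib] //.
- by subst; rewrite eqxx in ne_ab.
- move=> ew; subst i; apply: fin; [by left|lia|]; apply: (@addIm _ U_(mxvec_index a b)%MM).
  by rewrite -e' addmA.
- move=> ew; subst i; apply: fin; [by right|lia|]; apply: (@addIm _ U_(mxvec_index a b)%MM).
  by rewrite -e' [(U_(_) + _)%MM in RHS]addmC addmA.
- have ltm : (minn a b < n)%N by rewrite gtn_min ltn_ord.
  by move=> ew; lia.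
Qed.

Lemma brM_tr_X m :
  D 'X_[m] = \sum_q \sum_i ((m (ix q))%:R * (ord_sgn K i q.1 + ord_sgn K i q.2)) *:
    'X_[m - U_(ix q) + (U_(mxvec_index q.1 i) + U_(mxvec_index i q.2))].
Proof.
rewrite (derivation_mderiv _ (brM_derivation _)); apply: eq_bigr => q _.
rewrite mderivX brM_tr_gen mulr_sumr; apply: eq_bigr => i _.
by rewrite !mpolyXD -scalerAr -scalerAl scalerA mulrC.
Qed.

Lemma seq_argmax (T : eqType) (s : seq T) (g : T -> nat) : s != [::] ->
  exists2 x, x \in s & forall y, y \in s -> (g y <= g x)%N.
Proof.
case: s => // x s _; elim: s x => [|y s IH] x.
  by exists x; rewrite ?mem_head // => y; rewrite inE => /eqP->.
have [z zs zmax] := IH y; case: (leqP (g z) (g x)) => [le_zx|lt_xz].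
  exists x; rewrite ?mem_head // => t; rewrite inE => /predU1P[-> //|/zmax le_tz].
  exact: leq_trans le_zx.
exists z; first by rewrite in_cons zs orbT.
move=> t; rewrite inE => /predU1P[->|/zmax //].
exact: ltnW.
Qed.

(** If f is nonzero and restricts to 0, choose a monomial m0 of f with
    off-diagonal factors for which diag_wt + off_wt is largest, and let k be the
    index that realizes off_wt m0.  Then m0 * x_kk has in D f the coefficient of
    m0 in f times the number of off-diagonal factors of m0 in row or column k
    that have k as least index, which is positive. *)
Theorem diag_res_inj f : D f = 0 -> diag_res f = 0 -> f = 0.
Proof.
move=> Df res0; apply: contraPeq Df => f_neq0.
have [|m0 m0f m0max] := @seq_argmax _ (msupp f) (fun m => diag_wt m + off_wt m)%N.
  by rewrite msupp_eq0.
have [q0 off0 mq0] := diag_res_eq0 res0 m0f.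
have [q1 /andP[off1 mq1] m0V] : {q | off q && (0 < m0 (ix q))%N & off_wt m0 = (n - minn q.1 q.2)%N}.
  apply: (@eq_bigmax_cond _ [pred q | off q && (0 < m0 (ix q))%N] (fun q => (n - minn q.1 q.2)%N)).
  by apply/card_gt0P; exists q0; rewrite inE off0.
pose k := if (q1.1 < q1.2)%N then q1.1 else q1.2.
have kE : minn q1.1 q1.2 = k by rewrite /k /minn; case: ifP.
rewrite kE in m0V.
pose P q i := [&& off q, minn q.1 q.2 == k & i == k].
(* c counts the factors x_kl and x_lk of m0 with k < l. *)
pose c := (\sum_q \sum_i P q i * m0 (ix q))%N.
have lead q : off q -> minn q.1 q.2 = k -> ord_sgn K k q.1 + ord_sgn K k q.2 = 1 /\
    (U_(mxvec_index q.1 k) + U_(mxvec_index k q.2) = U_(ix q) + U_(mxvec_index k k))%MM.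
  case: q => a b /= /negP ne; rewrite /minn /ord_sgn.
  case: (ltngtP a b) => [lt|lt|/val_inj e]; last by rewrite e eqxx in ne.
    by move/val_inj => <-; rewrite ltnn lt (ltnNge b) (ltnW lt) /= !subr0 add0r addmC.
  by move/val_inj => <-; rewrite ltnn lt (ltnNge a) (ltnW lt) /= !subr0 addr0.
suff : (D f)@_(m0 + U_(mxvec_index k k)) = f@_m0 * c%:R.
  move=> e Df; move/eqP: e; rewrite Df mcoeff0 eq_sym mulf_eq0 -[_ == 0]negbK -mcoeff_msupp m0f /=.
  rewrite ((pcharf0P K).1 char0) /c (bigD1 q1) //= (bigD1 k) //= /P off1 kE !eqxx mul1n.
  by rewrite !addn_eq0 eqn0Ngt mq1.
rewrite {1}[f]mpolyE (derivation_sum _ _ _ (brM_derivation _)) raddf_sum /=.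
have termE m : m \in msupp f -> (D (f@_m *: 'X_[m]))@_(m0 + U_(mxvec_index k k)) =
    if m == m0 then f@_m0 * c%:R else 0.
  move=> mf; rewrite (derivationZ _ _ (brM_derivation _)) mcoeffZ brM_tr_X.
  rewrite raddf_sum /=.
  have -> : (if m == m0 then f@_m0 * c%:R else 0) =
      f@_m * \sum_q \sum_i ((m == m0) && P q i)%:R * (m (ix q))%:R.
    case: eqP => [->|_] /=.
      rewrite /c natr_sum; congr (_ * _); apply: eq_bigr => q _.
      by rewrite natr_sum; apply: eq_bigr => i _; rewrite natrM.
    by rewrite !big1 ?mulr0 // => q _; rewrite big1 // => i _; rewrite mul0r.
  congr (_ * _); apply: eq_bigr => q _; rewrite raddf_sum; apply: eq_bigr => i _ /=.
  rewrite mcoeffZ mcoeffX.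
  have [->|] := posnP (m (ix q)); first by rewrite mulr0 !mul0r.
  move=> mq; set s := _ + _.
  case: (eqVneq s 0) => [s0|s_neq0].
    rewrite s0 mulr0 mul0r; case: (boolP (_ && _)) => [|_]; last by rewrite mul0r.
    case/andP => _ /and3P[offq /eqP minq /eqP ik]; move: s0; rewrite /s ik.
    by rewrite (lead q offq minq).1 => /eqP; rewrite oner_eq0.
  case: eqP => [e|ne].
    have [-> offq minq ik] := top_monomial m0V (m0max m mf) mq s_neq0 e.
    by rewrite /s ik (lead q offq minq).1 /P offq minq !eqxx mulr1 mul1r mulr1.
  rewrite mulr0; case: (boolP (_ && _)) => [|_]; last by rewrite mul0r.
  case/andP => /eqP em /and3P[offq /eqP minq /eqP ik]; case: ne.
  by rewrite ik (lead q offq minq).2 addmA submK ?em // lep1mP -lt0n -em.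
rewrite big_seq (eq_bigr _ termE) -big_seq -big_mkcond.
by rewrite -big_filter filter_pred1_uniq ?msupp_uniq // big_seq1.
Qed.

End Injectivity.

(** * Subalgebras *)

Section Subalgebras.
Variables (K : fieldType) (A : comAlgType K).

Lemma poisson_centralizer_subalgebra (br : A -> A -> A) a :
  poisson_bracket_axioms br -> subalgebra (poisson_centralizer br a).
Proof.
move=> P; have dD := poisson_derivation a P.
split=> [|k u v /= u0 v0|u v /= u0 v0]; rewrite /poisson_centralizer /=.
- exact: derivation1 dD.
- by rewrite dD.1 u0 v0 scaler0 addr0.
- by rewrite dD.2 u0 v0 mul0r mulr0 addr0.
Qed.

Lemma subalgebra_mPo (S : set A) n (t : {mpoly K[n]}) (B : n.-tuple A) : subalgebra S ->
  (forall i, S (tnth B i)) -> S (\sum_(m <- msupp t) t@_m *: \prod_i tnth B i ^+ m i).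
Proof.
move=> [S1 Slin SM] SB.
have SX u k : S u -> S (u ^+ k).
  by move=> Su; elim: k => [|k IH]; rewrite ?expr0 // exprS; apply: SM.
have S0 : S 0 by rewrite -(addNr (1 : A)) -scaleN1r; apply: Slin.
elim/big_rec: _ => // m u _; apply: Slin.
by elim/big_rec: _ => // i v _; apply: SM; apply: SX.
Qed.

Lemma generated_subalgebra_sub (G S : set A) : subalgebra S ->
  (forall x, G x -> S x) -> forall x, generated_subalgebra G x -> S x.
Proof. by move=> subS GS x; apply. Qed.

Lemma generated_subalgebra_gen (G : set A) x : G x -> generated_subalgebra G x.
Proof. by move=> Gx S [_]; apply. Qed.

Lemma generated_subalgebraP (G : set A) : subalgebra (generated_subalgebra G).
Proof.
split=> [S [[]]//|k u v Gu Gv S SS|u v Gu Gv S SS].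
  by case: (SS.1) => _ Slin _; apply: Slin; [apply: Gu|apply: Gv].
by case: (SS.1) => _ _ SM; apply: SM; [apply: Gu|apply: Gv].
Qed.

End Subalgebras.

(** * Elementary and transposition matrices *)

Section ElementaryMatrices.
Variable n : nat.

Definition elementary_mx (R : comNzRingType) (i j : 'I_n) (a : R) : 'M[R]_n :=
  1%:M + a *: delta_mx i j.

Lemma elementary_mxN (R : comNzRingType) (i j : 'I_n) (a : R) : i != j ->
  elementary_mx i j a *m elementary_mx i j (- a) = 1%:M.
Proof.
move=> ne; rewrite /elementary_mx mulmxDl !mulmxDr !mulmx1 mul1mx.
rewrite -scalemxAl -scalemxAr mul_delta_mx_0 1?eq_sym // !scaler0 addr0.
by rewrite scaleNr addrNK.
Qed.

(** For a = 1 this is the permutation matrix of the transposition of i and j, up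
    to the sign of its (j, i) entry; changing a into - a inverts it. *)
Definition transposition_mx (R : comNzRingType) (i j : 'I_n) (a : R) : 'M[R]_n :=
  elementary_mx i j a *m (elementary_mx j i (- a) *m elementary_mx i j a).

Lemma transposition_mxN (R : comNzRingType) (i j : 'I_n) (a : R) : i != j ->
  transposition_mx i j a *m transposition_mx i j (- a) = 1%:M.
Proof.
move=> ne; rewrite /transposition_mx.
rewrite !mulmxA -[_ *m elementary_mx i j a *m _]mulmxA elementary_mxN // mulmx1.
rewrite -[_ *m elementary_mx j i (- a) *m _]mulmxA elementary_mxN 1?eq_sym // mulmx1.
by rewrite elementary_mxN.
Qed.

Lemma transposition_mx_diag (R : comNzRingType) (i j : 'I_n) (d : 'rV[R]_n) : i != j ->
  transposition_mx i j 1 *m diag_mx d *m transposition_mx i j (- 1)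
  = diag_mx (\row_k d 0 (tperm i j k)).
Proof.
move=> ne; rewrite -[RHS]mulmx1 -(transposition_mxN 1 ne) [RHS]mulmxA.
congr (_ *m _); apply/matrixP => k l.
have -> : transposition_mx i j (1 : R) =
    1%:M + delta_mx i j - delta_mx j i - delta_mx i i - delta_mx j j.
  rewrite /transposition_mx /elementary_mx !scaleN1r !scale1r.
  rewrite !(mulmxDl, mulmxDr, mul1mx, mulmx1, mulmxN, mulNmx, mul_delta_mx).
  rewrite !(mul_delta_mx_0, subr0, addr0) 1?eq_sym //.
  by apply/matrixP => a b; rewrite !mxE; ring.
rewrite mul_mx_diag mul_diag_mx !mxE.
have ne' : (j == i) = false by rewrite eq_sym (negbTE ne).
case: tpermP => [->|->|/eqP/negbTE ki /eqP/negbTE kj].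
- case: (eqVneq l i) => [->|/negbTE li]; first by rewrite !eqxx (negbTE ne) /=; ring.
  case: (eqVneq l j) => [->|/negbTE lj]; first by rewrite !eqxx (negbTE ne) /=; ring.
  by rewrite eqxx (negbTE ne) /=; ring.
- case: (eqVneq l j) => [->|/negbTE lj]; first by rewrite !eqxx ne' /=; ring.
  case: (eqVneq l i) => [->|/negbTE li]; first by rewrite !eqxx ne' /=; ring.
  by rewrite eqxx ne' /=; ring.
rewrite ki kj /=; case: (eqVneq k l) => [->|_] /=; ring.
Qed.

End ElementaryMatrices.

(** * The kernel of the trace flow *)

(** The degree of a composition is the product of the degrees: in a domain, a
    polynomial in one variable that is integral over the constants is constant. *)
Lemma monic_comp_eq0 (R : idomainType) (P u : {poly R}) :
  P \is monic -> P \Po u = 0 -> (size u <= 1)%N.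
Proof.
move=> Pmonic Pu; have := size_comp_poly P u; rewrite Pu size_poly0 /=.
move/esym/eqP; rewrite muln_eq0 => /orP[|]; last by case: (size u) => [|[]].
have : size P != 0%N by rewrite size_poly_eq0 monic_neq0.
case sP : (size P) => [|[|]] // _ _; exfalso; move: Pu.
rewrite (size1_polyC (eq_leq sP)) comp_polyC.
move: Pmonic; rewrite monicE lead_coefE sP /= => /eqP -> /eqP; by rewrite polyC_eq0 oner_eq0.
Qed.

Lemma derivationX0 (K : fieldType) (A : comAlgType K) (D : A -> A) u k :
  derivation D -> D u = 0 -> D (u ^+ k) = 0.
Proof.
move=> dD Du; elim: k => [|k IH]; first by rewrite expr0 (derivation1 dD).
by rewrite exprS dD.2 Du IH mul0r mulr0 addr0.
Qed.

Section TraceKernel.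
Variables (K : fieldType) (n : nat).
Hypothesis char0 : [pchar K] =i pred0.

Local Notation D := (brM (cM K n 1)).
Local Notation X := (xmx K n).

Definition cM_tuple : n.-tuple (OM K n) := [tuple cM K n i.+1 | i < n].

Lemma diag_res_mPo (t : {mpoly K[n]}) :
  diag_res (t \mPo cM_tuple) = t \mPo [tuple mesym n K i.+1 | i < n].
Proof.
rewrite !comp_mpolyE rmorph_sum; apply: eq_bigr => m _.
rewrite -!mul_mpolyC rmorphM /= {1}/diag_res eval_mxC rmorph_prod; congr (_ * _).
by apply: eq_bigr => i _; rewrite rmorphXn !tnth_mktuple -diag_res_cM.
Qed.

Lemma trace_centralizer_subalgebra : subalgebra (poisson_centralizer (@brM K n) (cM K n 1)).
Proof. exact/poisson_centralizer_subalgebra/brM_poisson. Qed.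

Lemma brM_tr_mPo (t : {mpoly K[n]}) : D (t \mPo cM_tuple) = 0.
Proof.
rewrite comp_mpolyE.
apply: (subalgebra_mPo (A := OM K n) _ trace_centralizer_subalgebra) => i.
by rewrite tnth_mktuple; apply: brM_tr_cM.
Qed.

(** The polynomial in the c_i that restricts to the symmetric polynomial p on the
    diagonal matrices. *)
Definition sym_lift (p : {mpoly K[n]}) : OM K n := symf p \mPo cM_tuple.

Lemma diag_res_sym_lift p : p \is symmetric -> diag_res (sym_lift p) = p.
Proof. by move=> psym; rewrite diag_res_mPo -symfP. Qed.

Lemma sym_liftK f : D f = 0 -> diag_res f \is symmetric -> sym_lift (diag_res f) = f.
Proof.
move=> Df fsym; have dD := brM_derivation (cM K n 1).
apply/eqP; rewrite -subr_eq0; apply/eqP/(diag_res_inj char0).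
  by rewrite (derivationD _ _ dD) (derivationN _ dD) brM_tr_mPo Df subr0.
by rewrite rmorphB /= diag_res_sym_lift ?subrr.
Qed.

Lemma sym_lift0 : sym_lift 0 = 0.
Proof.
by rewrite -{1}(rmorph0 (@diag_res K n)) sym_liftK ?rmorph0 ?rpred0
  ?(derivation0 (brM_derivation _)).
Qed.

Lemma sym_lift1 : sym_lift 1 = 1.
Proof.
by rewrite -{1}(rmorph1 (@diag_res K n)) sym_liftK ?rmorph1 ?rpred1
  ?(derivation1 (brM_derivation _)).
Qed.

(** The restriction p of f is a root of Q, the product of the T - s(p) over all
    permutations s of the variables.  The lift P of Q satisfies D (P(f)) = 0, and
    P(f) restricts to Q(p) = 0. *)
Lemma trace_kernel_integral f : D f = 0 ->
  exists2 P : {poly OM K n}, P \is monic &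
    (forall k, exists t : {mpoly K[n]}, P`_k = t \mPo cM_tuple) /\ P.[f] = 0.
Proof.
move=> Df; pose p := diag_res f.
pose Q : {poly {mpoly K[n]}} := \prod_(s : 'S_n) ('X - (msym s p)%:P).
have Qsym k : Q`_k \is symmetric.
  apply/issymP => s; rewrite -coef_map; congr (nth 0 (polyseq _) k).
  rewrite /Q rmorph_prod [RHS](reindex_inj (mulIg s)); apply: eq_bigr => s' _ /=.
  by rewrite rmorphB /= map_polyX map_polyC /= msymMm.
have Qmonic : Q \is monic by apply: monic_prod => i _; apply: monicXsubC.
have Qp : Q.[p] = 0.
  rewrite /Q horner_prod.
  apply/eqP/prodf_eq0.
  exists (1%g : 'S_n) => //.
  rewrite msym1m.
  by rewrite hornerXsubC subrr.
pose P := \poly_(k < size Q) sym_lift Q`_k.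
have Pn k : P`_k = sym_lift Q`_k.
  by rewrite coef_poly; case: ltnP => // le; rewrite nth_default // sym_lift0.
exists P; last split=> [k|].
  have Qlead : sym_lift Q`_(size Q).-1 = 1 by rewrite -lead_coefE (monicP Qmonic) sym_lift1.
  rewrite monicE lead_coef_poly ?Qlead ?oner_neq0 //.
  by rewrite lt0n size_poly_eq0 monic_neq0.
- by rewrite Pn; exists (symf Q`_k).
apply: (diag_res_inj char0).
  have dD := brM_derivation (cM K n 1).
  rewrite /P horner_poly (derivation_sum _ _ _ dD) big1 // => k _.
  by rewrite dD.2 (derivationX0 _ dD Df) brM_tr_mPo mul0r mulr0 addr0.
rewrite horner_poly rmorph_sum /= -[RHS]Qp horner_coef; apply: eq_bigr => k _.
by rewrite rmorphM rmorphXn /= diag_res_sym_lift.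
Qed.

(** Conjugation of the generic matrix by 1 + t E_ij, where t is the variable of
    the outer polynomial ring. *)
Definition conj_var (i j : 'I_n) : OM K n -> {poly OM K n} :=
  eval_mx (polyC \o @mpolyC (n * n) K)
    (elementary_mx i j 'X *m map_mx polyC X *m elementary_mx i j (- 'X)).

HB.instance Definition _ i j := GRing.RMorphism.copy (conj_var i j) (eval_mx _ _).

Lemma conj_var_mPo i j (t : {mpoly K[n]}) : i != j ->
  conj_var i j (t \mPo cM_tuple) = (t \mPo cM_tuple)%:P.
Proof.
move=> ne; rewrite comp_mpolyE !rmorph_sum; apply: eq_bigr => m _.
rewrite -mul_mpolyC !rmorphM /= {1}/conj_var eval_mxC /=; congr (_ * _).
rewrite !rmorph_prod; apply: eq_bigr => k _; rewrite !rmorphXn /=; congr (_ ^+ _).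
rewrite tnth_mktuple /conj_var eval_mx_cM cminor_conj ?elementary_mxN //; last first.
  by rewrite -{2}['X]opprK elementary_mxN.
rewrite /cM rmorph_sum; apply: eq_bigr => S _; rewrite -det_map_mx; congr (\det _).
by apply/matrixP => a b; rewrite !mxE.
Qed.

Lemma map_mx_entry (R S : Type) (h : R -> S) p q (B : 'M_(p, q)) k l :
  h (B k l) = map_mx h B k l.
Proof. by rewrite mxE. Qed.

Lemma map_mxM3 (R S : pzSemiRingType) (h : {rmorphism R -> S}) p (B1 B2 B3 : 'M_p) :
  map_mx h (B1 *m B2 *m B3) = map_mx h B1 *m map_mx h B2 *m map_mx h B3.
Proof. by rewrite !map_mxM. Qed.

Lemma map_elementary_mx (R S : comNzRingType) (h : {rmorphism R -> S}) (i j : 'I_n) a :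
  map_mx h (elementary_mx i j a) = elementary_mx i j (h a).
Proof. by rewrite /elementary_mx map_mxD map_mxZ map_mx1 map_delta_mx. Qed.

Lemma map_transposition_mx (R S : comNzRingType) (h : {rmorphism R -> S}) (i j : 'I_n) a :
  map_mx h (transposition_mx i j a) = transposition_mx i j (h a).
Proof. by rewrite /transposition_mx !map_mxM !map_elementary_mx rmorphN. Qed.

Lemma horner_conj_var i j b f : (conj_var i j f).[b] =
  eval_mx (@mpolyC _ K) (elementary_mx i j b *m X *m elementary_mx i j (- b)) f.
Proof.
apply: (eval_mx_uniq (f := horner_eval b \o conj_var i j)) => [k|k l] /=.
  by rewrite /conj_var !eval_mxC /horner_eval /= hornerC.
rewrite /conj_var !eval_mx_var.
rewrite (map_mx_entry (horner_eval b)); congr (fun_of_matrix _ k l).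
have evC : map_mx (horner_eval b) (map_mx polyC X) = X.
  by apply/matrixP => p q; rewrite !mxE /horner_eval hornerC.
rewrite map_mxM3 evC.
by rewrite !map_elementary_mx /= rmorphN /= /horner_eval hornerX.
Qed.

(** The image of f satisfies the monic equation of f, whose coefficients
    conj_var fixes.  Hence it does not depend on t, and t = 0 gives f. *)
Lemma conj_var_kernel i j f : i != j -> D f = 0 -> conj_var i j f = f%:P.
Proof.
move=> ne Df; have [P Pmonic [Pco Pf]] := trace_kernel_integral Df.
have : P \Po conj_var i j f = 0.
  rewrite -[RHS](rmorph0 (conj_var i j)) -Pf horner_coef comp_polyE rmorph_sum.
  apply: eq_bigr => k _; rewrite rmorphM rmorphXn /= -mul_polyC.
  by have [t ->] := Pco k; rewrite conj_var_mPo.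
move/(monic_comp_eq0 Pmonic)/size1_polyC => ->; congr (_%:P).
rewrite -horner_coef0 horner_conj_var /elementary_mx oppr0 scale0r addr0 mul1mx mulmx1.
apply: (eval_mx_uniq (g := idfun)) => [k|k l]; first exact: eval_mxC.
by rewrite /= eval_mx_var mxE.
Qed.

Definition conj_mx (g h : 'M[K]_n) : OM K n -> OM K n :=
  eval_mx (@mpolyC (n * n) K) (map_mx (@mpolyC _ K) g *m X *m map_mx (@mpolyC _ K) h).

HB.instance Definition _ g h := GRing.RMorphism.copy (conj_mx g h) (eval_mx _ _).

Lemma conj_mxM g h g' h' f : conj_mx g h (conj_mx g' h' f) = conj_mx (g' *m g) (h *m h') f.
Proof.
apply: (eval_mx_uniq (f := conj_mx g h \o conj_mx g' h')) => [k|k l] /=.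
  by rewrite /conj_mx !eval_mxC.
rewrite {2}/conj_mx {2}/conj_mx !eval_mx_var.
rewrite (map_mx_entry (conj_mx g h)); congr (fun_of_matrix _ k l).
rewrite map_mxM3 /= eval_mx_xmx.
have CC (B : 'M[K]_n) : map_mx (conj_mx g h) (map_mx (@mpolyC _ K) B) = map_mx (@mpolyC _ K) B.
  by apply/matrixP => a b; rewrite !mxE /conj_mx eval_mxC.
by rewrite !CC !map_mxM !mulmxA.
Qed.

Lemma conj_elementary_kernel i j (a : K) f : i != j -> D f = 0 ->
  conj_mx (elementary_mx i j a) (elementary_mx i j (- a)) f = f.
Proof.
move=> ne Df; transitivity ((conj_var i j f).[a%:MP]); last by rewrite conj_var_kernel // hornerC.
by rewrite horner_conj_var /conj_mx !map_elementary_mx rmorphN.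
Qed.

(** A signed transposition matrix is a product of three elementary matrices, so
    conjugation by it fixes f, while it exchanges two diagonal entries of a
    diagonal matrix. *)
Lemma diag_res_symmetric f : D f = 0 -> diag_res f \is symmetric.
Proof.
move=> Df; have tpermE i j : msym (tperm i j) (diag_res f) = diag_res f.
  case: (eqVneq i j) => [->|ne]; first by rewrite tperm1 msym1m.
  have cf : conj_mx (transposition_mx i j 1) (transposition_mx i j (- 1)) f = f.
    rewrite /transposition_mx opprK [elementary_mx i j (- 1) *m _]mulmxA.
    rewrite -conj_mxM conj_elementary_kernel // -conj_mxM.
    have := conj_elementary_kernel (i := j) (j := i) (- 1); rewrite opprK => -> //.
      exact: conj_elementary_kernel.
    by rewrite eq_sym.
  rewrite -{2}cf.
  apply: (eval_mx_uniq (f := msym (tperm i j) \o @diag_res K n)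
    (g := @diag_res K n \o conj_mx _ _)) => [k|k l] /=.
    by rewrite /conj_mx /diag_res !eval_mxC [LHS]mmapC.
  rewrite {1}/diag_res {1}/conj_mx !eval_mx_var.
  rewrite (map_mx_entry (@diag_res K n)) map_mxM3 /= eval_mx_xmx.
  have CC (C : 'M[K]_n) : map_mx (@diag_res K n) (map_mx (@mpolyC _ K) C) = map_mx (@mpolyC _ K) C.
    by apply/matrixP => a b; rewrite !mxE /diag_res eval_mxC.
  rewrite !CC !map_transposition_mx rmorphN rmorph1 transposition_mx_diag // !mxE.
  case: (eqVneq k l) => [_|ne_kl]; last by rewrite !mulr0n rmorph0.
  by rewrite !mulr1n [LHS]mmapX mmap1U.
apply/issymP => s; have [ts -> _] := prod_tpermP s.
elim: ts => [|[i j] ts IH]; first by rewrite big_nil msym1m.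
by rewrite big_cons msymMm tpermE.
Qed.

Theorem trace_kernel f : D f = 0 -> exists t : {mpoly K[n]}, f = t \mPo cM_tuple.
Proof.
move=> Df; exists (symf (diag_res f)).
by rewrite -/(sym_lift _) sym_liftK ?diag_res_symmetric.
Qed.

End TraceKernel.

(** * The centralizers in the three coordinate rings *)

Section Generation.
Variables (K : fieldType) (n : nat).
Hypothesis char0 : [pchar K] =i pred0.

Local Notation D := (brM (cM K n 1)).
Local Notation det := (\det (xmx K n)).

Lemma trace_kernel_subalgebra (S : set (OM K n)) f : subalgebra S ->
  (forall i, (1 <= i <= n)%N -> S (cM K n i)) -> D f = 0 -> S f.
Proof.
move=> subS Sc /(trace_kernel char0)[t ->]; rewrite comp_mpolyE.
apply: (subalgebra_mPo (A := OM K n)) => // i; rewrite tnth_mktuple.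
by apply: Sc; rewrite /= ltn_ord.
Qed.

Lemma subalgebra_preimage (A B : comAlgType K) (phi : A -> B) (S : set B) :
  linear phi -> monoid_morphism phi -> subalgebra S -> subalgebra (fun a => S (phi a)).
Proof.
move=> lin [phi1 phiM] [S1 Slin SM].
split=> [|k u v Su Sv|u v Su Sv]; rewrite ?phi1 ?lin ?phiM //; [exact: Slin|exact: SM].
Qed.

Theorem trace_centralizer_OM :
  poisson_centralizer (@brM K n) (cM K n 1) =
  generated_subalgebra [set cM K n i | i in [set i | (1 <= i <= n)%N]]%classic.
Proof.
rewrite predeqE => f; split=> [|]; rewrite /poisson_centralizer /=.
  apply: (trace_kernel_subalgebra (generated_subalgebraP _)) => i ni.
  by apply: generated_subalgebra_gen; exists i.
move: f; apply: (generated_subalgebra_sub (A := OM K n)).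
  exact: trace_centralizer_subalgebra.
by move=> _ [i _ <-]; apply: brM_tr_cM.
Qed.

Lemma fracGL_eq0 (f : OM K n) k : fracGL f k = 0 <-> f = 0.
Proof.
rewrite -(rmorph0 (@iotaGL K n)); split=> [/fracGL_eq|->].
  by rewrite expr0 mulr1 mul0r.
by apply/fracGL_eq; rewrite !mul0r.
Qed.

Theorem trace_centralizer_OGL :
  poisson_centralizer (@brGL K n) (cGL K n 1) =
  generated_subalgebra ([set cGL K n i | i in [set i | (1 <= i <= n)%N]]
            `|` [set (cGL K n n)^-1])%classic.
Proof.
rewrite predeqE => x; split=> [|]; rewrite /poisson_centralizer /=.
  set G := (_ `|` _)%classic; have subG := generated_subalgebraP (A := OGL K n) G.
  have [f [k ->]] := fracGLP x; rewrite brGL_frac add0n => /fracGL_eq0 Df.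
  have -> : fracGL f k = iotaGL f * (cGL K n n)^-1 ^+ k.
    rewrite cGLnV; have -> : fracGL (1 : OM K n) 1 ^+ k = fracGL 1 k.
      elim: k => [|k IH]; first by rewrite expr0 -(rmorph1 (@iotaGL K n)).
      by rewrite exprS IH fracGLM mulr1.
    by rewrite fracGLM mulr1.
  have [G1 _ GM] := subG; apply: (GM).
    have subP : subalgebra (fun f : OM K n => generated_subalgebra G (iotaGL f)).
      apply: subalgebra_preimage subG => [a u v|]; last exact: iotaGL_monoid_morphism.
      by rewrite rmorphD /= -[iotaGL (a *: u)]fracGLZ.
    apply: (trace_kernel_subalgebra subP) Df => i ni.
    by apply: generated_subalgebra_gen; left; exists i.
  elim: k => [|k IH]; first by rewrite expr0.
  by rewrite exprS; apply: (GM) IH; apply: generated_subalgebra_gen; right.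
move: x; apply: (generated_subalgebra_sub (A := OGL K n)).
  exact/poisson_centralizer_subalgebra/brGL_poisson.
move=> _ [[i _ <-]|->]; rewrite /poisson_centralizer /=.
  by rewrite brGL_iota brM_tr_cM // rmorph0.
by rewrite cGLnV brGL_frac (derivation1 (brM_derivation _)); apply/fracGL_eq0.
Qed.

(** The substitution X |-> t X, which turns the grading of O(M_n) by the degree
    into the grading by the powers of t. *)
Definition scale_var : OM K n -> {poly OM K n} :=
  eval_mx (polyC \o @mpolyC (n * n) K) ('X *: map_mx polyC (xmx K n)).

HB.instance Definition _ := GRing.RMorphism.copy scale_var (eval_mx _ _).

Lemma scale_var_homog d p : p \is d.-homog -> scale_var p = p%:P * 'X^d.
Proof.
move=> /dhomogP pd; rewrite [in LHS](mpolyE p) [in RHS](mpolyE p) !rmorph_sum mulr_suml.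
rewrite big_seq [RHS]big_seq; apply: eq_bigr => m /pd <-.
rewrite -mul_mpolyC !rmorphM /= -mulrA {1}/scale_var eval_mxC; congr (_ * _).
rewrite mpolyXE_id !rmorph_prod mdegE /= -prodrXr -big_split; apply: eq_bigr => a _ /=.
rewrite !rmorphXn -exprMn; congr (_ ^+ _); case/mxvec_indexP: a => i j.
by rewrite [LHS]eval_mx_var !mxE mulrC.
Qed.

Lemma scale_var_det : scale_var det = det%:P * 'X^n.
Proof.
rewrite -det_map_mx eval_mx_xmx detZ mulrC -[det%:P]det_map_mx.
by [].
Qed.

Lemma horner_scale_var f : (scale_var f).[1] = f.
Proof.
apply: (eval_mx_uniq (f := horner_eval 1 \o scale_var) (g := idfun)) => [k|i j] /=.
  by rewrite /scale_var eval_mxC /horner_eval hornerC.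
by rewrite /scale_var eval_mx_var !mxE /horner_eval hornerM hornerX hornerC mul1r.
Qed.

Lemma brM_tr_homog d p : p \is d.-homog -> D p \is d.+1.-homog.
Proof.
move=> /dhomogP pd; rewrite [p]mpolyE (derivation_sum _ _ _ (brM_derivation _)).
rewrite big_seq; apply: rpred_sum => m mp; rewrite (derivationZ _ _ (brM_derivation _)).
apply: rpredZ; rewrite brM_tr_X; apply: rpred_sum => q _; apply: rpred_sum => i _.
have [->|mq] := posnP (m (mxvec_index q.1 q.2)); first by rewrite mul0r scale0r rpred0.
apply: rpredZ; rewrite dhomogX /= !mdegD !mdeg1.
have : (U_(mxvec_index q.1 q.2) <= m)%MM by rewrite lep1mP -lt0n.
move/submK/(congr1 (@mdeg _)); rewrite mdegD mdeg1; have := pd m mp => /=; lia.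
Qed.

(** The lowest term of p * (c 'X^m - 1) is minus that of p, its highest one is c
    'X^m times that of p, so their degrees differ by at least m when p is nonzero. *)
Lemma mul_XnB1_window (R : idomainType) (c : R) (m a : nat) (p : {poly R}) : (0 < m)%N -> c != 0 ->
  (forall j, ~~ (a <= j < a + m)%N -> (p * (c%:P * 'X^m - 1))`_j = 0) -> p = 0.
Proof.
move=> m0 c0 win.
have co j : (p * (c%:P * 'X^m - 1))`_j = (if (j < m)%N then 0 else c * p`_(j - m)) - p`_j.
  by rewrite mulrBr mulr1 coefB mulrCA coefCM coefMXn; case: ifP; rewrite ?mulr0.
have low j : (j < a)%N -> p`_j = 0.
  elim/ltn_ind: j => j IH ja; have := win j; rewrite leqNgt ja co => /(_ isT)/eqP.
  rewrite subr_eq0 => /eqP <-; case: ltnP => // mj; rewrite IH ?mulr0 //; first by lia.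
  by lia.
apply/eqP/contraT => p0; have sp : (0 < size p)%N by rewrite lt0n size_poly_eq0.
have le_a : (a <= (size p).-1)%N.
  by rewrite leqNgt; apply: contra p0 => /low; rewrite -lead_coefE => /eqP; rewrite lead_coef_eq0.
have := win ((size p).-1 + m)%N; rewrite co.
have -> : (((size p).-1 + m < m) = false)%N by rewrite ltnNge leq_addl.
rewrite addnK [p`_(_ + m)]nth_default; last by rewrite -{1}(prednK sp) -addn1 leq_add2l.
have -> : (a <= (size p).-1 + m < a + m)%N = false by rewrite ltn_add2r ltnNge le_a andbF.
by move/(_ isT)/eqP; rewrite subr0 mulf_eq0 (negbTE c0) -lead_coefE lead_coef_eq0 (negbTE p0).
Qed.

Lemma piSL_det : piSL det = 1.
Proof.
rewrite -(rmorph1 (@piSL K n)); apply/piSL_eqP.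
by exists 1; rewrite mul1r.
Qed.

(** The component f_d of degree d is multiplied by det ^ (N - d / n), with N a
    common bound.  Its image under D then has degree n N + (d mod n) + 1, one of n
    consecutive values.  A multiple h (det - 1) with all its degrees in such a
    window is zero. *)
Lemma trace_kernel_mod_det f : (0 < n)%N -> piSL (D f) = 0 ->
  exists2 F, D F = 0 & piSL F = piSL f.
Proof.
move=> n0 Df; have dD := brM_derivation (cM K n 1).
pose N := msize f; pose e (d : 'I_N) := (N - d %/ n)%N.
have fE := pihomog_partitionE (leqnn (msize f)); rewrite -/N in fE.
pose F := \sum_(d < N) pihomog mdeg d f * det ^+ e d.
have piF : piSL F = piSL f.
  rewrite [in RHS]fE !rmorph_sum; apply: eq_bigr => d _.
  by rewrite rmorphM rmorphXn /= piSL_det expr1n mulr1.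
exists F => //.
have : piSL (D F) = 0 by rewrite -Df -!brSL_pi piF.
rewrite -(rmorph0 (@piSL K n)) => /piSL_eqP[h]; rewrite subr0 => DF.
suff h0 : scale_var h = 0.
  by rewrite DF -(horner_scale_var h) h0 horner0 mul0r.
apply: (@mul_XnB1_window _ det n (n * N).+1) => // [|j jw]; first exact: det_neq0.
have -> : det%:P * 'X^n - 1 = scale_var (det - 1) by rewrite rmorphB rmorph1 /= scale_var_det.
rewrite -rmorphM -DF (derivation_sum _ _ _ dD) rmorph_sum coef_sum big1 // => d _.
have detX : D (det ^+ e d) = 0.
  by apply: derivationX0 => //; rewrite -cMn brM_tr_cM.
have hom : D (pihomog mdeg d f) \is d.+1.-homog by apply/brM_tr_homog/pihomogP.
rewrite dD.2 detX mulr0 addr0 rmorphM rmorphXn /= scale_var_det (scale_var_homog hom).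
rewrite exprMn -exprM mulrACA -rmorphXn -rmorphM -exprD coefCM coefXn.
case: eqP => [ej|]; last by rewrite mulr0.
case/negP: jw; rewrite ej /e.
have := divn_eq d n; have := ltn_pmod d n0; have := ltn_ord d; have := leq_div d n.
move: (d %/ n)%N (d %% n)%N => x y; move: (nat_of_ord d) => D' le_xD ltD lty eD.
have -> : (n * (N - x) = n * N - n * x)%N by rewrite mulnBr.
have le_nx : (n * x <= n * N)%N by rewrite leq_mul2l; apply/orP; right; lia.
lia.
Qed.

Theorem trace_centralizer_OSL : (0 < n)%N ->
  poisson_centralizer (@brSL K n) (cSL K n 1) =
  generated_subalgebra [set cSL K n i | i in [set i | (1 <= i <= n - 1)%N]]%classic.
Proof.
move=> n0; rewrite predeqE => x; split=> [|]; rewrite /poisson_centralizer /=.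
  set G := image _ _; have subG := generated_subalgebraP (A := OSL K n) G.
  rewrite -(reprSLK x) brSL_pi => /(trace_kernel_mod_det n0)[F DF <-].
  have subP : subalgebra (fun f : OM K n => generated_subalgebra G (piSL f)).
    apply: subalgebra_preimage subG => [a u v|]; last exact: piSL_monoid_morphism.
    by rewrite rmorphD /= piSLZ.
  apply: (trace_kernel_subalgebra subP) DF => i /andP[i1]; rewrite leq_eqVlt.
  case/predU1P => [->|lt_in]; first by rewrite cMn piSL_det; case: subG.
  by apply: generated_subalgebra_gen; exists i => //=; lia.
move: x; apply: (generated_subalgebra_sub (A := OSL K n)).
  exact/poisson_centralizer_subalgebra/brSL_poisson.
by move=> _ [i _ <-]; rewrite /poisson_centralizer /= brSL_pi brM_tr_cM // rmorph0.
Qed.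

End Generation.

Theorem theorem1p2 (R : realType) (n : nat) (n_ge1 : (1 <= n)%N) :
  [/\ poisson_centralizer (@brSL R[i] n) (cSL R[i] n 1) =
        generated_subalgebra [set cSL R[i] n i | i in [set i | (1 <= i <= n - 1)%N]]%classic,
      poisson_centralizer (@brM R[i] n) (cM R[i] n 1) =
        generated_subalgebra [set cM R[i] n i | i in [set i | (1 <= i <= n)%N]]%classic &
      poisson_centralizer (@brGL R[i] n) (cGL R[i] n 1) =
        generated_subalgebra
          ([set cGL R[i] n i | i in [set i | (1 <= i <= n)%N]]
            `|` [set (cGL R[i] n n)^-1])%classic].
Proof.
have char0 : [pchar R[i]] =i pred0 by exact: Num.Theory.pchar_num.
split; first exact: trace_centralizer_OSL.
  exact: trace_centralizer_OM.
exact: trace_centralizer_OGL.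
Qed.
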